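(* Let $R_1>0$ and $a>0$, and let $V\in C^\infty(\mathbb{R}^2)$ be a non-negative function such that, in polar coordinates $(r,\theta)$ on $\mathbb{R}^2$, for all $r>R_1$ and all $\theta$, $$V(r,\theta)\le \frac{a}{r}\qquad\text{and}\qquad \partial_rV(r,\theta)+\frac{2}{r}V(r,\theta)\ge 0 .$$ Let $H_0(q,p)=\frac12(p_1^2+p_2^2)+p_1q_2-p_2q_1$ and $H(q,p)=H_0(q,p)-V(q)$ on $T^*\mathbb{R}^2$. Let $q_0,q_1\in\mathbb{R}^2$ with $|q_0|,|q_1|\le R_1$, and let $$\mathcal{H}=\left\{h\in C^\infty(T^*\mathbb{R}^2)\ :\ dh \text{ has compact support},\ h>0,\ h-dh(p\,\partial_p)>0\right\}.$$ Then: 1. For every $c>\max\left\{\sqrt[3]{32a^2},\ \sqrt{4a\left(3R_1+2\sqrt[3]{2a}\right)}\right\}$ there exists $h\in\mathcal{H}$ such that $\operatorname{Crit}^+(\mathcal{A}^{H_0-h}_{q_0,q_1})\subseteq\operatorname{Crit}^+(\mathcal{A}^{H-c}_{q_0,q_1})$. 2. If $\partial_\theta V(r,\theta)=0$ for all $r\ge R_1$ and all $\theta$, then for every $c>\max\{\inf V,\sqrt{2aR_1}\}$ there exists $h\in\mathcal{H}$ such that $\operatorname{Crit}^+(\mathcal{A}^{H_0-h}_{q_0,q_1})=\operatorname{Crit}^+(\mathcal{A}^{H-c}_{q_0,q_1})$.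
   Context: $T^*\mathbb{R}^2\cong\mathbb{R}^2\times\mathbb{R}^2$ has coordinates $(q,p)=(q_1,q_2,p_1,p_2)$ (inside the formula for $H_0$, $q_1,q_2$ denote the coordinates of the position $q$; elsewhere $q_0,q_1$ are the two end points in $\mathbb{R}^2$), Liouville form $\lambda=p\,dq$ and symplectic form $\omega=d\lambda$. Here $p\,\partial_p=p_1\partial_{p_1}+p_2\partial_{p_2}$. The Hamiltonian vector field of $F$ is $X_F=\sum_i\left(\partial_{p_i}F\,\partial_{q_i}-\partial_{q_i}F\,\partial_{p_i}\right)$. Let $\mathscr{H}_{q_0,q_1}=\{v\in W^{1,2}([0,1],T^*\mathbb{R}^2): v(i)\in T^*_{q_i}\mathbb{R}^2,\ i=0,1\}$. For a smooth function $F$ on $T^*\mathbb{R}^2$, the Rabinowitz action functional $\mathcal{A}^F_{q_0,q_1}:\mathscr{H}_{q_0,q_1}\times\mathbb{R}\to\mathbb{R}$ is $$\mathcal{A}^F_{q_0,q_1}(v,\eta)=\int_0^1\lambda(\partial_tv)\,dt-\eta\int_0^1F(v(t))\,dt .$$ Its critical set $\operatorname{Crit}(\mathcal{A}^F_{q_0,q_1})$ consists of the pairs $(v,\eta)\in\mathscr{H}_{q_0,q_1}\times\mathbb{R}$ with $\partial_tv=\eta X_F(v)$ and $v([0,1])\subseteq F^{-1}(0)$. $\operatorname{Crit}^+(\mathcal{A}^F_{q_0,q_1})$ denotes the set of critical points with positive action, i.e. those $(v,\eta)\in\operatorname{Crit}(\mathcal{A}^F_{q_0,q_1})$ with $\mathcal{A}^F_{q_0,q_1}(v,\eta)>0$.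 *)

(* Defs.v *)
From HB Require Import structures.
From mathcomp Require Import all_boot all_order all_algebra.
From mathcomp Require Import all_classical all_reals all_analysis.

Set Implicit Arguments.
Unset Strict Implicit.
Unset Printing Implicit Defensive.

Import Order.TTheory GRing.Theory Num.Theory.
Import numFieldNormedType.Exports.

Local Open Scope classical_set_scope.
Local Open Scope ring_scope.

(* Coordinates are numbered from 0: the mathematical q_1, q_2 are q 0 0, q 0 1. *)
Notation plane R := 'rV[R]_2.

(* T^*R^2 as pairs x = (q, p), with q = x.1 and p = x.2. *)
Notation phase R := ('rV[R]_2 * 'rV[R]_2)%type.

(* The library norm on row vectors is the sup norm. *)
Definition enorm {R : realType} (q : plane R) : R :=
  Num.sqrt (\sum_(i < 2) q 0 i ^+ 2).

Definition cbrt {R : realType} (x : R) : R := x `^ (3%:R^-1).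

Definition polar {R : realType} (r theta : R) : plane R :=
  \row_(i < 2) (if i == 0 then r * cos theta else r * sin theta).

Definition dpolar_r {R : realType} (f : plane R -> R) (r theta : R) : R :=
  derive1 (fun s : R => f (polar s theta)) r.

Definition dpolar_theta {R : realType} (f : plane R -> R) (r theta : R) : R :=
  derive1 (fun t : R => f (polar r t)) theta.

(* On a finite-dimensional space, f is C^(n+1) iff it is differentiable and all
   its directional derivatives are C^n. *)
Fixpoint Ck {R : realType} {E : normedModType R} (n : nat) (f : E -> R) : Prop :=
  match n with
  | 0 => continuous f
  | n'.+1 => (forall x, differentiable f x) /\ (forall v, Ck n' ('D_v f))
  end.

Definition smooth {R : realType} {E : normedModType R} (f : E -> R) : Prop :=
  forall n, Ck n f.

Definition d_dq {R : realType} (i : 'I_2) (F : phase R -> R) (x : phase R) : R :=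
  'D_((delta_mx 0 i, 0) : phase R) F x.

Definition d_dp {R : realType} (i : 'I_2) (F : phase R -> R) (x : phase R) : R :=
  'D_((0, delta_mx 0 i) : phase R) F x.

Definition ham_vf {R : realType} (F : phase R -> R) (x : phase R) : phase R :=
  (\row_i d_dp i F x, \row_i - d_dq i F x).

Definition liouville {R : realType} (x w : phase R) : R :=
  \sum_(i < 2) x.2 0 i * w.1 0 i.

(* p d/dp, as a map to tangent vectors *)
Definition pdp {R : realType} (x : phase R) : phase R := (0, x.2).

Definition H0 {R : realType} (x : phase R) : R :=
  2^-1 * (x.2 0 0 ^+ 2 + x.2 0 1 ^+ 2) + x.2 0 0 * x.1 0 1 - x.2 0 1 * x.1 0 0.

Definition L2 {R : realType} (g : R -> R) : Prop :=
  measurable_fun (`[0, 1] : set R) g /\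
  (@lebesgue_measure R).-integrable `[0, 1] (fun t => (g t ^+ 2)%:E).

(* u is absolutely continuous on [0,1] with derivative g in L^2([0,1]). *)
Definition is_L2_derivative {R : realType} (u g : R -> R) : Prop :=
  L2 g /\
  forall t, t \in `[0, 1] ->
    u t = u 0 + \int[@lebesgue_measure R]_(s in `[0, t]) g s.

Definition is_path_derivative {R : realType} (v w : R -> phase R) : Prop :=
  forall i : 'I_2,
    is_L2_derivative (fun t => (v t).1 0 i) (fun t => (w t).1 0 i) /\
    is_L2_derivative (fun t => (v t).2 0 i) (fun t => (w t).2 0 i).

(* W^{1,2}([0,1], T^*R^2): absolutely continuous paths with square integrable
   derivative.  A path is a function on R of which only the values on [0,1]
   are ever constrained or used. *)
Definition W12 {R : realType} (v : R -> phase R) : Prop :=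
  exists w, is_path_derivative v w.

(* A representative of the derivative of v, which is unique up to null sets. *)
Definition path_derivative {R : realType} (v : R -> phase R) : R -> phase R :=
  xget (fun=> 0) [set w | is_path_derivative v w].

Definition path_space {R : realType} (q0 q1 : plane R) : set (R -> phase R) :=
  [set v | [/\ W12 v, (v 0).1 = q0 & (v 1).1 = q1]].

Definition action {R : realType} (F : phase R -> R)
    (v : R -> phase R) (eta : R) : R :=
  \int[@lebesgue_measure R]_(t in `[0, 1]) liouville (v t) (path_derivative v t)
  - eta * \int[@lebesgue_measure R]_(t in `[0, 1]) F (v t).

Definition Crit {R : realType} (q0 q1 : plane R) (F : phase R -> R) :
    set ((R -> phase R) * R) :=
  [set z | [/\ path_space q0 q1 z.1,
      {ae @lebesgue_measure R, forall t, t \in `[0, 1] ->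
         path_derivative z.1 t = z.2 *: ham_vf F (z.1 t)} &
      forall t, t \in `[0, 1] -> F (z.1 t) = 0]].

Definition Crit_pos {R : realType} (q0 q1 : plane R) (F : phase R -> R) :
    set ((R -> phase R) * R) :=
  [set z | Crit q0 q1 F z /\ 0 < action F z.1 z.2].

Definition compactly_supported_d {R : realType} (h : phase R -> R) : Prop :=
  compact (closure [set x | exists v : phase R, 'd h x v != 0]).

Definition admissible {R : realType} : set (phase R -> R) :=
  [set h | [/\ smooth h, compactly_supported_d h,
               forall x, 0 < h x & forall x, 0 < h x - 'd h x (pdp x)]].

(* Main.v *)
Require Import Defs.
From HB Require Import structures.
From mathcomp Require Import all_boot all_order all_algebra.
From mathcomp Require Import all_classical all_reals all_analysis.
From mathcomp Require Import ring lra.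
Import Order.TTheory GRing.Theory Num.Theory.
Import numFieldNormedType.Exports.
Local Open Scope classical_set_scope.
Local Open Scope ring_scope.

(* Take h = c + V(q) X(|q|^2) Y(|p|^2) with decreasing smooth steps X and Y,
   where X = 1 for |q| <= r0, X = 0 for |q| >= 2 r0 for some r0 >= R1, and
   Y = 1 for the momenta that the level set {H0 = h} allows on the support
   of X.  On that level set the flow of H0 - h is then the flow of H0 - W - c
   with W = V X(|q|^2), along which
     (|q|^2/2)'' = eta^2 (|p|^2 + q . grad W).
   Wherever this is positive for |q| > R1, |q| has no interior maximum above
   R1, so that all chords between q0 and q1 stay in {|q| <= R1}, where h = V + c
   for the momenta that occur, and they are the same for both Hamiltonians.
   Their actions agree because both Hamiltonians vanish along them.

   In part 1, |p|^2 + q . grad W <= 0 would force |p|^2 <= 2 V (X - |q|^2 X'),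
   and H0 = |p|^2/2 - L = W + c with |L| <= |q| |p|, where L is the angular
   momentum (ang below), would bound c.
   In part 2, |p|^2 = 2 (W + c + L), L is conserved while |q| >= R1, and L > - c
   where |q| = R1; a slow cutoff (large r0) preserves the positivity. *)

Set Implicit Arguments.
Unset Strict Implicit.
Unset Printing Implicit Defensive.

(** * Closure properties of smooth functions *)

Lemma Ck_succ {R : realType} {E : normedModType R} n (f : E -> R) :
  Ck n.+1 f -> (forall x, differentiable f x) /\ (forall v, Ck n ('D_v f)).
Proof. by []. Qed.

Section smooth_closure.
Context {R : realType} {E : normedModType R}.
Implicit Types (f g : E -> R) (n : nat).

Lemma CkW n f : Ck n.+1 f -> Ck n f.
Proof.
elim: n f => [|n IHn] f /Ck_succ[fd fD].
  by move=> x; exact/differentiable_continuous.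
by split=> // v; exact/IHn/fD.
Qed.

Lemma Ck_cst n (c : R) : Ck n (cst c : E -> R).
Proof.
elim: n c => [|n IHn] c; first by move=> x; exact: cvg_cst.
split=> [x|v]; first exact: differentiable_cst.
have -> : 'D_v (cst c : E -> R) = cst 0; last by exact: IHn.
by apply/funext => x; rewrite derive_cst.
Qed.

Lemma CkD n f g : Ck n f -> Ck n g -> Ck n (f \+ g).
Proof.
elim: n f g => [|n IHn] f g.
  by move=> fc gc x; apply: cvgD; [exact: fc|exact: gc].
move=> /Ck_succ[fd fD] /Ck_succ[gd gD]; split=> [x|v].
  exact: differentiableD.
have -> : 'D_v (f \+ g) = 'D_v f \+ 'D_v g; last exact: IHn.
by apply/funext => x; rewrite deriveD//; exact: diff_derivable.
Qed.

Lemma CkM n f g : Ck n f -> Ck n g -> Ck n (f \* g).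
Proof.
elim: n f g => [|n IHn] f g.
  by move=> fc gc x; apply: cvgM; [exact: fc|exact: gc].
move=> fC gC; have [fd fD] := Ck_succ fC; have [gd gD] := Ck_succ gC; split=> [x|v].
  exact: differentiableM.
have -> : 'D_v (f \* g) = (f \* 'D_v g) \+ (g \* 'D_v f).
  by apply/funext => x; rewrite deriveM//; exact: diff_derivable.
by apply: CkD; apply: IHn => //; exact: CkW.
Qed.

Lemma Ck_linear n (l : {linear E -> R^o}) : continuous l -> Ck n (l : E -> R).
Proof.
move=> lc; case: n => [//|n]; split=> [x|v].
  exact: linear_differentiable.
have -> : 'D_v (l : E -> R) = cst (l v); last by exact: Ck_cst.
apply/funext => x; rewrite deriveE ?diff_lin//.
exact: linear_differentiable.
Qed.

Lemma derive_comp (X : R -> R) f x v :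
  differentiable X (f x) -> differentiable f x ->
  'D_v (X \o f) x = 'D_1 X (f x) * 'D_v f x.
Proof.
move=> Xd fd; have Xfd : differentiable (X \o f) x by exact: differentiable_comp.
rewrite (deriveE _ Xfd) (deriveE _ fd) (diff_comp fd Xd) /=.
by rewrite (diff1E Xd) derive1E mulrC.
Qed.

Lemma Ck_comp n (X : R -> R) f : Ck n X -> Ck n f -> Ck n (X \o f).
Proof.
elim: n X f => [|n IHn] X f.
  by move=> Xc fc x; apply: continuous_comp; [exact: fc|exact: Xc].
move=> XC fC; have [Xd XD] := Ck_succ XC; have [fd fD] := Ck_succ fC; split=> [x|v].
  exact: differentiable_comp.
have -> : 'D_v (X \o f) = ('D_1 X \o f) \* 'D_v f.
  by apply/funext => x; rewrite derive_comp.
by apply: CkM => //; apply: IHn => //; exact: CkW.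
Qed.

Lemma derive_comp_linear {E' : normedModType R} (f : E' -> R)
    (l : {linear E -> E'}) x v :
  continuous l -> differentiable f (l x) ->
  'D_v (f \o l) x = 'D_(l v) f (l x).
Proof.
move=> lc fd; have ld : differentiable l x by exact: linear_differentiable.
have fld : differentiable (f \o l) x by exact: differentiable_comp.
rewrite (deriveE _ fld) (deriveE _ fd) (diff_comp ld fd) /=.
by rewrite (diff_lin x lc).
Qed.

Lemma Ck_comp_linear {E' : normedModType R} n (f : E' -> R)
    (l : {linear E -> E'}) :
  continuous l -> Ck n f -> Ck n (f \o l).
Proof.
move=> lc; elim: n f => [|n IHn] f.
  by move=> fc x; apply: continuous_comp; [exact: lc|exact: fc].
move=> /Ck_succ[fd fD]; split=> [x|v].
  by apply: differentiable_comp => //; exact: linear_differentiable.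
have -> : 'D_v (f \o l) = 'D_(l v) f \o l; last by apply: IHn.
by apply/funext => x; rewrite derive_comp_linear.
Qed.

End smooth_closure.

Section smooth_real.
Context {R : realType}.

Lemma Ck_id n : Ck n (id : R -> R).
Proof.
case: n => [|n]; first by move=> x; exact: cvg_id.
split=> [x|v]; first by apply/derivable1_diffP; exact: derivable_id.
have -> : 'D_v (id : R -> R) = cst v; last by exact: Ck_cst.
by apply/funext => x; rewrite derive_id.
Qed.

(** On the line every directional derivative is a multiple of the one in direction 1, so a formula
    for the ordinary derivative suffices. *)
Lemma Ck_is_derive n (f df : R -> R) :
  (forall x, is_derive x (1 : R) f (df x)) -> Ck n df -> Ck n.+1 f.
Proof.
move=> fdf dfC.
have fd x : differentiable f x.
  by apply/derivable1_diffP; have [] := fdf x.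
split=> // v.
have -> : 'D_v f = cst v \* df; last by apply: CkM => //; exact: Ck_cst.
apply/funext => x; rewrite deriveE// diff1E//= derive1E.
by have [_ ->] := fdf x.
Qed.

End smooth_real.

(** * Smooth steps of controlled slope *)

Section step.
Context {R : realType}.
Implicit Types (t x : R) (k n : nat).

(** The difference quotient at 0 is at most C |h|. This settles the gluing point of [flat]. *)
Lemma is_derive_sqr_bound (f : R -> R) (C : R) :
  (forall h, `|f h| <= C * h ^+ 2) -> is_derive 0 (1 : R) f 0.
Proof.
move=> fC.
have f0 : f 0 = 0.
  by apply/eqP; rewrite -normr_le0 (le_trans (fC 0))// expr0n mulr0.
have C0 : 0 <= C by have := le_trans (normr_ge0 _) (fC 1); rewrite expr1n mulr1.
have cv : h^-1 *: (f (h *: 1 + 0) - f 0) @[h --> (0 : R)^'] --> (0 : R).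
  apply/cvgrPdist_le => e e0.
  near=> h.
  have h0 : h != 0 by near: h; exact: nbhs_dnbhs_neq.
  rewrite f0 sub0r normrN subr0 addr0 [h *: 1]mulr1 normrZ normfV.
  rewrite ler_pdivrMl ?normr_gt0//.
  apply: le_trans (fC h) _.
  rewrite -(real_normK (num_real h)) expr2 mulrCA ler_wpM2l//.
  have hC : `|h| <= e / (C + 1).
    near: h; apply: dnbhs0_le.
    by rewrite divr_gt0// ltr_wpDl.
  apply: le_trans (ler_wpM2l C0 hC) _.
  rewrite mulrA ler_pdivrMr ?ltr_wpDl// mulrDr mulr1 mulrC lerDl.
  exact: ltW.
apply: DeriveDef; first by apply/cvg_ex; exists 0.
exact: (cvg_lim _ cv).
Unshelve. all: by end_near. Qed.

(** The classical flat function exp(-1/t) is [flat 0]. The powers t^-k make the family closed under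
    differentiation up to linear combinations, so smoothness follows by induction for all k at
    once. *)
Definition flat k t : R := if 0 < t then t ^- k * expR (- t^-1) else 0.

Lemma flat_ge0 k t : 0 <= flat k t.
Proof.
rewrite /flat; case: ifPn => // t0.
by rewrite mulr_ge0 ?expR_ge0// invr_ge0 exprn_ge0// ltW.
Qed.

(** The bound exp u >= u^(k+2) / (k+2)! at u = 1/t leaves a factor t^2 after division by t^k. *)
Lemma flat_le_sqr k t : flat k t <= k.+2`!%:R * t ^+ 2.
Proof.
rewrite /flat; case: ifPn => [t0|_]; last by rewrite mulr_ge0 ?sqr_ge0.
have u0 : 0 < t^-1 by rewrite invr_gt0.
have e : t^-1 ^+ k.+2 / k.+2`!%:R <= expR (t^-1).
  apply: le_trans (expR_ge1Dxn k.+1 (ltW u0)).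
  by rewrite lerDr.
rewrite expRN -exprVn ler_pdivrMr ?expR_gt0//.
have := ler_wpM2l (mulr_ge0 (ler0n _ k.+2`!) (sqr_ge0 t)) e.
apply: le_trans; rewrite 2!exprS.
have f0 : k.+2`!%:R != 0 :> R by rewrite pnatr_eq0 -lt0n fact_gt0.
have tn0 : t != 0 by rewrite gt_eqF.
rewrite le_eqVlt; apply/orP; left; apply/eqP; rewrite !(exprS t^-1).
move: (t^-1 ^+ k) k.+2`!%:R f0 => y F F0; field; by rewrite F0.
Qed.

Lemma is_derive_flat k t :
  is_derive t (1 : R) (flat k) (flat k.+2 t - k%:R * flat k.+1 t).
Proof.
have [t0|t0|->] := ltgtP t 0.
- apply: (@near_eq_is_derive _ _ _ (cst 0)).
  + near=> s; rewrite /flat ltNge /= ltW//; near: s; exact: lt_nbhsl.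
  + by rewrite /flat ltNge (ltW t0)/= mulr0 subr0; exact: is_derive_cst.
- apply: (@near_eq_is_derive _ _ _ (fun s : R => s ^- k * expR (- s^-1) : R)).
  + near=> s; rewrite /flat ifT//; near: s; exact: lt_nbhsr.
  + rewrite /flat t0.
    have tn0 : t != 0 by rewrite gt_eqF.
    have dV := is_deriveV tn0 (is_derive_id t 1).
    have dX : is_derive t (1 : R) (fun s => s ^- k) (- k%:R * t ^- k.+1).
      have dp : is_derive t (1 : R) (fun s : R => s ^+ k) (k%:R * t ^+ k.-1).
        apply: DeriveDef; first exact: exprn_derivable.
        by rewrite exp_derive scaler1.
      have tk0 : t ^+ k != 0 by rewrite expf_neq0.
      apply: is_derive_eq (is_deriveV (f := fun s => s ^+ k) tk0 dp) _.
      rewrite -![_ *: _]/(_ * _); case: (k) => [|j] /=.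
        by rewrite !(mul0r, mulr0, oppr0).
      by rewrite !exprS; field; rewrite expf_neq0 tn0.
    have dE : is_derive t (1 : R) (fun s => expR (- s^-1)) (t ^- 2 * expR (- t^-1)).
      have dN : is_derive t (1 : R) (fun s : R => - s^-1) (t ^- 2).
        apply: is_derive_eq (is_deriveN dV) _.
        by rewrite -[_ *: _]/(_ * _) mulr1 opprK.
      rewrite mulrC; exact: is_derive1_comp (is_derive_expR _) dN.
    apply: is_derive_eq (is_deriveM dX dE) _.
    rewrite -![_ *: _]/(_ * _).
    rewrite !exprS; field; rewrite ?expf_neq0 ?tn0//.
- rewrite /flat ltxx mulr0 subr0; apply: (@is_derive_sqr_bound _ k.+2`!%:R) => h.
  by rewrite ger0_norm ?flat_ge0//; exact: flat_le_sqr.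
Unshelve. all: by end_near. Qed.

Lemma Ck_flat n k : Ck n (flat k).
Proof.
elim: n k => [|n IHn] k.
  move=> t; apply: differentiable_continuous; apply/derivable1_diffP.
  by have [] := is_derive_flat k t.
apply: (@Ck_is_derive _ _ _ (flat k.+2 \+ (cst (- k%:R) \* flat k.+1))).
  by move=> t; apply: is_derive_eq (is_derive_flat k t) _; rewrite /= mulNr.
by apply: CkD => //; apply: CkM => //; exact: Ck_cst.
Qed.

(* The factor 4000 makes bump close enough to 1 on [1/40, 39/40] for its
   integral to exceed 8/9. *)
Definition bump t : R := flat 0 (4 * 10 ^+ 3 * t) * flat 0 (4 * 10 ^+ 3 * (1 - t)).

Lemma Ck_bump n : Ck n bump.
Proof.
have Cl (a b : R) : Ck n (fun t => flat 0 (a * (b + t))).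
  apply: (@Ck_comp _ _ _ (flat 0) (cst a \* (cst b \+ id))).
    exact: Ck_flat.
  by apply: CkM; [exact: Ck_cst|apply: CkD; [exact: Ck_cst|exact: Ck_id]].
rewrite /bump; move: (4 * _) => K.
have -> : (fun t => flat 0 (K * t) * flat 0 (K * (1 - t))) =
    (fun t => flat 0 (K * (0 + t))) \* (fun t => flat 0 (- K * (- 1 + t))).
  by apply/funext => t /=; rewrite add0r; congr (_ * flat 0 _); ring.
by apply: CkM; exact: Cl.
Qed.

Lemma bump_ge0 t : 0 <= bump t.
Proof. by rewrite mulr_ge0 ?flat_ge0. Qed.

Lemma flat_le0 k t : t <= 0 -> flat k t = 0.
Proof. by move=> t0; rewrite /flat ltNge t0. Qed.

Lemma bump_le0 t : t <= 0 -> bump t = 0.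
Proof.
move=> t0; rewrite /bump (flat_le0 0) ?mul0r//.
by rewrite mulr_ge0_le0// mulr_ge0// exprn_ge0.
Qed.

Lemma bump_ge1 t : 1 <= t -> bump t = 0.
Proof.
move=> t1; rewrite /bump mulrC (flat_le0 0) ?mul0r//.
by rewrite mulr_ge0_le0 ?subr_le0// mulr_ge0// exprn_ge0.
Qed.

Lemma flat0_le1 t : flat 0 t <= 1.
Proof.
rewrite /flat; case: ifPn => // t0.
by rewrite expr0 invr1 mul1r -expR0 ler_expR oppr_le0 invr_ge0 ltW.
Qed.

Lemma bump_le1 t : bump t <= 1.
Proof. by rewrite mulr_ile1 ?flat_ge0 ?flat0_le1. Qed.

Lemma flat0_ge t : 0 < t -> 1 - t^-1 <= flat 0 t.
Proof.
by move=> t0; rewrite /flat t0 expr0 invr1 mul1r; exact: expR_ge1Dx.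
Qed.

(** On this interval both arguments of [flat 0] are at least 100, so each factor is at least 1 -
    1/100. *)
Lemma bump_plateau t : 1 / 40 <= t <= 39 / 40 -> (99 / 100) ^+ 2 <= bump t.
Proof.
move=> /andP[tl tr].
have h (s : R) : 1 / 40 <= s -> 99 / 100 <= flat 0 (4 * 10 ^+ 3 * s).
  move=> sl; have s0 : 100 <= 4 * 10 ^+ 3 * s by lra.
  have p0 : 0 < 4 * 10 ^+ 3 * s by apply: lt_le_trans s0.
  have := flat0_ge p0.
  have : (4 * 10 ^+ 3 * s)^-1 <= 100^-1 by rewrite lef_pV2 ?posrE.
  move: (flat _ _) (_^-1 : R) => y z; lra.
by rewrite expr2; apply: ler_pM; rewrite ?divr_ge0//; apply: h; lra.
Qed.

Lemma mvt_global (f df : R -> R) x y : (forall t, is_derive t (1 : R) f (df t)) ->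
  x <= y -> exists2 c, x <= c <= y & f y - f x = df c * (y - x).
Proof.
move=> fdf xy.
have fc : {within `[x, y], continuous f}.
  apply: continuous_subspaceT => t; apply: differentiable_continuous.
  by apply/derivable1_diffP; have [] := fdf t.
have [c cxy e] := MVT_segment xy (fun t _ => fdf t) fc.
by exists c.
Qed.

Lemma continuous_primitive (b : R -> R) :
  continuous b -> (forall t, t <= 0 -> b t = 0) ->
  exists G : R -> R, forall t, is_derive t (1 : R) G (b t).
Proof.
move=> bc b0; pose mu := @lebesgue_measure R.
(* The base point -1 lies where b vanishes: G is zero to the left of 0, and elsewhere t is interior
   to [-1, t + 1], where the fundamental theorem of calculus applies. *)
pose G x := \int[mu]_(t in `[-1, x]) b t; exists G => t.
have [t0|t0] := ltP t 0.
  rewrite b0 ?ltW//; apply: (@near_eq_is_derive _ _ _ (cst 0)).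
    near=> s; rewrite /G.
    have s0 : s < 0 by near: s; exact: lt_nbhsl.
    rewrite (@eq_Rintegral _ _ _ _ _ (cst 0)) => [|u].
      by rewrite Rintegral_cst// mul0r.
    by rewrite inE/= in_itv/= => /andP[_ us]; rewrite b0// (le_trans us)// ltW.
have tt1 : t < t + 1 by rewrite ltrDl.
have bi : mu.-integrable `[-1, t + 1] (EFin \o b).
  apply: continuous_compact_integrable; first exact: segment_compact.
  exact: continuous_subspaceT.
have t1 : -1 < t by apply: lt_le_trans t0; rewrite ltrN10.
have [Gd Ge] := continuous_FTC1_closed tt1 bi t1 (bc t).
by apply: (DeriveDef Gd); rewrite -derive1E; exact: Ge.
Unshelve. all: by end_near. Qed.

End step.

(* The affine step has slope - 1 / (r1 - r0).  The constants in
   energy_threshold only allow a factor close to 1 above that. *)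
Record step {R : realType} (r0 r1 : R) (X X' : R -> R) : Prop := Step {
  step_smooth : smooth X ;
  step_derive : forall t, is_derive t (1 : R) X (X' t) ;
  step_one : forall t, t <= r0 -> X t = 1 /\ X' t = 0 ;
  step_zero : forall t, r1 <= t -> X t = 0 /\ X' t = 0 ;
  step_bound : forall t, 0 <= X t <= 1 ;
  step_slope : forall t, - (9 / 8) / (r1 - r0) <= X' t <= 0 }.

(** X is 1 minus the normalised primitive of [bump], precomposed with the affine map of [r0, r1]
    onto [0, 1]. As [bump] is at most 1 and its integral I at least 8/9, the slope exceeds the
    affine one by a factor of at most 9/8. *)
Lemma smooth_step {R : realType} (r0 r1 : R) : r0 < r1 ->
  exists X X' : R -> R, step r0 r1 X X'.
Proof.
move=> r01; have d0 : 0 < r1 - r0 by rewrite subr_gt0.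
have [G Gd] : exists G : R -> R, forall t, is_derive t (1 : R) G (bump t).
  by apply: continuous_primitive; [exact: (Ck_bump 0)|exact: bump_le0].
have Gm x y : x <= y -> G x <= G y.
  move=> xy; have [c _ e] := mvt_global Gd xy.
  by rewrite -subr_ge0 e mulr_ge0 ?bump_ge0// subr_ge0.
have Gl t : t <= 0 -> G t = G 0.
  move=> t0; have [c /andP[_ c0] e] := mvt_global Gd t0.
  by apply/eqP; rewrite eq_sym -subr_eq0 e bump_le0 ?mul0r.
have Gr t : 1 <= t -> G t = G 1.
  move=> t0; have [c /andP[c0 _] e] := mvt_global Gd t0.
  by apply/eqP; rewrite -subr_eq0 e bump_ge1 ?mul0r.
(* The plateau alone contributes (38/40) (99/100)^2, about 0.931. *)
have GI : 8 / 9 <= G 1 - G 0.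
  have h0 : G 0 <= G (1 / 40) by apply: Gm; lra.
  have h1 : G (39 / 40) <= G 1 by apply: Gm; lra.
  have [|c cb e] := mvt_global (x := 1 / 40) (y := 39 / 40) Gd; first by lra.
  by have := bump_plateau cb; nra.
set I := G 1 - G 0 in GI *; have I0 : 0 < I by apply: lt_le_trans GI; lra.
pose u t := (t - r0) / (r1 - r0).
have ud t : is_derive t (1 : R) u ((r1 - r0)^-1).
  have -> : u = (r1 - r0)^-1 \*: (id - cst r0).
    by apply/funext => s; rewrite /u/= mulrC.
  have h := is_deriveZ (r1 - r0)^-1
    (is_deriveB (is_derive_id t (1 : R)) (is_derive_cst r0 t (1 : R))).
  apply: is_derive_eq h _.
  by rewrite subr0 -[_ *: _]/(_ * _) mulr1.
pose X t := 1 - (G (u t) - G 0) / I.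
pose X' t := - (bump (u t) / (r1 - r0)) / I.
have Xd t : is_derive t (1 : R) X (X' t).
  have -> : X = cst 1 - (I^-1 \*: ((G \o u) - cst (G 0))).
    by apply/funext => s; rewrite /X/= mulrC.
  have Gud := is_derive1_comp (Gd (u t)) (ud t).
  have h := is_deriveB (is_derive_cst (1 : R) t (1 : R))
    (is_deriveZ I^-1 (is_deriveB Gud (is_derive_cst (G 0) t (1 : R)))).
  apply: is_derive_eq h _.
  by rewrite subr0 sub0r -[_ *: _]/(_ * _) /X' mulNr mulrC.
have ule t : t <= r0 -> u t <= 0.
  by move=> t0; rewrite /u pmulr_lle0 ?invr_gt0// subr_le0.
have uge t : r1 <= t -> 1 <= u t.
  by move=> t0; rewrite /u ler_pdivlMr// mul1r lerD2r.
exists X, X'; split => //.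
- move=> n; apply: CkW; apply: (Ck_is_derive Xd).
  have -> : X' = cst (- (r1 - r0)^-1 / I) \* (bump \o u).
    by apply/funext => s; rewrite /X'/=; ring.
  apply: CkM; first exact: Ck_cst.
  apply: Ck_comp; first exact: Ck_bump.
  by apply: CkW; apply: (Ck_is_derive ud); exact: Ck_cst.
- move=> t /ule ut; rewrite /X /X' Gl// bump_le0//.
  by rewrite subrr !(mul0r, oppr0) addr0.
- move=> t /uge ut; rewrite /X /X' Gr// bump_ge1//.
  by rewrite mul0r oppr0 mul0r divff ?subrr ?gt_eqF.
- move=> t; rewrite /X.
  have h0 : 0 <= (G (u t) - G 0) / I.
    rewrite divr_ge0 ?(ltW I0)// subr_ge0.
    by have [/Gl ->//|/ltW/Gm] := leP (u t) 0.
  have h1 : (G (u t) - G 0) / I <= 1.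
    rewrite ler_pdivrMr// mul1r lerD2r.
    by have [/Gr ->//|/ltW/Gm] := leP 1 (u t).
  by lra.
- move=> t; rewrite /X'.
  have h : bump (u t) / I <= 9 / 8.
    by rewrite ler_pdivrMr//; have := bump_le1 (u t); lra.
  have h0 : 0 <= bump (u t) / I by rewrite divr_ge0 ?bump_ge0 ?ltW.
  have -> : - (bump (u t) / (r1 - r0)) / I = - (bump (u t) / I) / (r1 - r0).
    by field; rewrite !gt_eqF.
  by rewrite ler_pM2r ?invr_gt0// lerN2 h/= pmulr_lle0 ?invr_gt0// oppr_le0.
Qed.

(** * Sobolev paths solving an ordinary differential equation *)

Section paths.
Context {R : realType}.
Notation mu := (@lebesgue_measure R).

Lemma cvg_row {T : Type} {F : set_system T} {FF : Filter F} n (f : T -> 'rV[R]_n)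
    (l : 'rV[R]_n) :
  (forall i, f t 0 i @[t --> F] --> l 0 i) -> f t @[t --> F] --> l.
Proof.
move=> fl A [P nP sub].
have : \forall t \near F, forall i, P 0 i (f t 0 i).
  by apply: filter_forall => i; exact: fl.
by apply: filterS => t Pt; apply: sub => i j; rewrite (ord1 i).
Qed.

(** Domination by 1 + g^2 on an interval of finite measure. *)
Lemma L2_integrable (g : R -> R) : L2 g -> mu.-integrable `[0, 1] (EFin \o g).
Proof.
move=> [mg ig].
have i1 : mu.-integrable `[0, 1] (EFin \o cst (1 : R)).
  apply: continuous_compact_integrable; first exact: segment_compact.
  by move=> ?; exact: cvg_cst.
have : mu.-integrable `[0, 1] ((EFin \o cst 1%R) \+ (fun t => (g t ^+ 2)%:E))%E.
  by apply: integrableD.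
apply: le_integrable => //.
  exact/measurable_realfun.measurable_EFinP.
move=> t _; rewrite [leRHS]/(`|(1 + g t ^+ 2)%:E|)%E /= lee_fin.
rewrite [leRHS]ger0_norm ?addr_ge0 ?sqr_ge0//.
by rewrite -(real_normK (num_real (g t))); nra.
Qed.

Lemma L2_derivative_continuous (u g : R -> R) :
  is_L2_derivative u g -> {within `[0, 1], continuous u}.
Proof.
move=> [/L2_integrable gi ug].
apply: (@subspace_eq_continuous _ _ _
  (fun t => u 0 + parameterized_integral mu 0 t g)).
  by move=> t; rewrite inE/= => /ug tE; rewrite /from_subspace/= tE.
move=> t; apply: cvgD; first exact: cvg_cst.
exact: parameterized_integral_continuous.
Qed.

(** The integral does not see null sets, so u is also the primitive of the continuous function k,
    and the fundamental theorem applies. In this way weak solutions of the Hamiltonian equation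
    become classical ones. *)
Lemma L2_derivative_is_derive (u g k : R -> R) :
  is_L2_derivative u g ->
  {ae mu, forall t, t \in `[0, 1] -> g t = k t} ->
  {within `[0, 1], continuous k} ->
  forall t : R, t \in `]0, 1[ -> is_derive t (1 : R) u (k t).
Proof.
move=> [L2g ug] gk kc t; rewrite in_itv/= => /andP[t0 t1].
have gi := L2_integrable L2g.
have ki : mu.-integrable `[0, 1] (EFin \o k).
  by apply: continuous_compact_integrable; [exact: segment_compact|].
have sub (s : R) : s <= 1 -> `[0, s] `<=` `[0, 1].
  by move=> s1; apply: subset_itvl; rewrite bnd_simp.
have uk (s : R) : 0 <= s <= 1 -> u s = u 0 + \int[mu]_(r in `[0, s]) k r.
  move=> /andP[s0 s1]; rewrite ug ?in_itv/= ?s0//; congr (_ + fine _).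
  apply: ae_eq_integral => //=.
  - by apply: (measurable_int mu); apply: integrableS gi => //; exact: sub.
  - by apply: (measurable_int mu); apply: integrableS ki => //; exact: sub.
  - apply: (@filterS _ _ (ae_filter_ringOfSetsType mu)) gk => r gkr rs.
    by congr EFin; apply: gkr; exact: sub s s1 _ rs.
have kt : {for t, continuous k}.
  have s01 : `]0, 1[ `<=` (`[0, 1] : set R) by move=> r; exact: subset_itv_oo_cc.
  have := continuous_subspaceW s01 kc.
  rewrite continuous_open_subspace; last exact: interval_open.
  by apply; rewrite inE/= in_itv/= t0.
have [Gd Ge] := continuous_FTC1_closed t1 ki t0 kt.
have h : is_derive t (1 : R) (fun s => \int[mu]_(r in `[0, s]) k r) (k t).
  by apply: (DeriveDef Gd); rewrite -derive1E; exact: Ge.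
have h' := is_deriveD (is_derive_cst (u 0) t (1 : R)) h.
rewrite add0r in h'; apply: near_eq_is_derive h'.
near=> s.
have s0 : 0 <= s by apply: ltW; near: s; exact: lt_nbhsr.
have s1 : s <= 1 by near: s; exact: lt_le_nbhsl.
have s01 : 0 <= s <= 1 by rewrite s0 s1.
by rewrite [in RHS](uk s s01).
Unshelve. all: by end_near. Qed.

Lemma path_derivativeP (v : R -> phase R) :
  W12 v -> is_path_derivative v (path_derivative v).
Proof. by move=> [w vw]; exact: (xgetPex (fun=> 0) (ex_intro _ w vw)). Qed.

Lemma W12_continuous (v : R -> phase R) : W12 v -> {within `[0, 1], continuous v}.
Proof.
move=> /path_derivativeP vw t.
have h : (fun s => ((v s).1, (v s).2)) = v by apply/funext => s; case: (v s).
rewrite -h; apply: (@cvg_pair _ _ _ (nbhs t) (nbhs (v t).1) (nbhs (v t).2));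
  apply: cvg_row => i; have [qi pi] := vw i.
- exact: (L2_derivative_continuous qi).
- exact: (L2_derivative_continuous pi).
Qed.

Lemma W12_is_derive (v : R -> phase R) (Y : phase R -> phase R) :
  W12 v -> (forall i, continuous (fun x => (Y x).1 0 i)) ->
  (forall i, continuous (fun x => (Y x).2 0 i)) ->
  {ae mu, forall t, t \in `[0, 1] -> path_derivative v t = Y (v t)} ->
  forall t : R, t \in `]0, 1[ -> forall i : 'I_2,
    is_derive t (1 : R) (fun s => (v s).1 0 i) ((Y (v t)).1 0 i) /\
    is_derive t (1 : R) (fun s => (v s).2 0 i) ((Y (v t)).2 0 i).
Proof.
move=> Wv Yq Yp vY t t01 i.
have vc := W12_continuous Wv; have [qi pi] := path_derivativeP Wv i.
split.
- apply: (@L2_derivative_is_derive _ _ (fun s => (Y (v s)).1 0 i) qi) => //.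
    apply: (@filterS _ _ (ae_filter_ringOfSetsType mu)) vY => s vs s01.
    by rewrite vs.
  by move=> s; exact: (continuous_comp (vc s) (Yq i (v s))).
- apply: (@L2_derivative_is_derive _ _ (fun s => (Y (v s)).2 0 i) pi) => //.
    apply: (@filterS _ _ (ae_filter_ringOfSetsType mu)) vY => s vs s01.
    by rewrite vs.
  by move=> s; exact: (continuous_comp (vc s) (Yp i (v s))).
Qed.

End paths.

(** * A maximum principle on the time interval *)

Section dynamics.
Context {R : realType}.
Implicit Types (phi psi chi L : R -> R) (t s M : R).

Lemma is_derive_gt0_right psi t c : is_derive t (1 : R) psi c -> 0 < c ->
  psi t = 0 -> exists2 d, 0 < d & forall h, 0 < h < d -> 0 < psi (t + h).
Proof.
move=> [dpsi <-] c0 pt.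
have := cvgr_gt _ dpsi _ c0 => -[d /= d0 H]; exists d => // h /andP[h0 hd].
have := H h; rewrite /= sub0r normrN gtr0_norm// => /(_ hd).
rewrite gt_eqF// => /(_ isT).
by rewrite /= pt subr0 [h *: 1]mulr1 addrC pmulr_rgt0// invr_gt0.
Qed.

(** At an interior maximum m above M, phi' = psi vanishes and psi' = chi is positive. Hence psi > 0
    just to the right of m, so phi increases there, against maximality. *)
Lemma max_principle phi psi chi M :
  {within `[0, 1], continuous phi} ->
  (forall t, t \in `]0, 1[ -> is_derive t (1 : R) phi (psi t)) ->
  (forall t, t \in `]0, 1[ -> is_derive t (1 : R) psi (chi t)) ->
  phi 0 <= M -> phi 1 <= M ->
  (forall t, t \in `]0, 1[ -> M < phi t -> 0 < chi t) ->
  forall t, t \in `[0, 1] -> phi t <= M.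
Proof.
move=> phic dphi dpsi M0 M1 chi0.
have [m m01 mmax] := EVT_max ler01 phic.
suff mM : phi m <= M by move=> t /mmax tm; exact: le_trans mM.
rewrite leNgt; apply/negP => Mm.
have mo : m \in `]0, 1[.
  move: m01; rewrite !in_itv/= !le_eqVlt => /andP[/predU1P[m0|->] /predU1P[m1|->]] //.
  - by move: Mm; rewrite -m0 ltNge M0.
  - by move: Mm; rewrite -m0 ltNge M0.
  - by move: Mm; rewrite m1 ltNge M1.
have psim : psi m = 0.
  have oo t : t \in `]0, 1[ -> t \in `[0, 1] by exact: subset_itv_oo_cc.
  have [|_ e] := derive1_at_max ler01 _ mo (fun t t01 => mmax t (oo t t01)).
    by move=> t /dphi[].
  by have [_ <-] := dphi _ mo.
have [d d0 dpos] := is_derive_gt0_right (dpsi m mo) (chi0 m mo Mm) psim.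
have /andP[m0 m1] : 0 < m < 1 by move: mo; rewrite in_itv.
pose h := Num.min (d / 2) (1 - m).
have h0 : 0 < h by rewrite lt_min divr_gt0// subr_gt0.
have hd : h < d by rewrite gt_min; apply/orP; left; lra.
have h1 : m + h <= 1 by rewrite -lerBrDl ge_min lexx orbT.
have sub : `[m, m + h] `<=` `[0, 1].
  move=> t /=; rewrite !in_itv/= => /andP[mt th].
  by rewrite (le_trans (ltW m0) mt) (le_trans th h1).
have mh : m < m + h by rewrite ltrDl.
have phic' := continuous_subspaceW sub phic.
have dphi' t : t \in `]m, m + h[ -> is_derive t (1 : R) phi (psi t).
  rewrite in_itv/= => /andP[mt th]; apply: dphi.
  by rewrite in_itv/= (lt_trans m0 mt) (lt_le_trans th h1).
have [c cmh e] := MVT mh dphi' phic'.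
have cpos : 0 < psi c.
  move: cmh; rewrite in_itv/= => /andP[mc ch].
  have := dpos (c - m); rewrite [m + _]addrC subrK; apply.
  by rewrite subr_gt0 mc/= ltrBlDl (lt_trans ch)// ltrD2l.
have : phi (m + h) <= phi m by apply: mmax; rewrite in_itv/= h1 addr_ge0// ltW.
by rewrite -subr_le0 e [m + h - m]addrC addKr pmulr_lle0// leNgt cpos.
Qed.

(** The time s is the largest element of the compact set of times in [0, t] at which phi is at most
    M. *)
Lemma last_crossing phi M t : {within `[0, 1], continuous phi} -> phi 0 <= M ->
  t \in `]0, 1[ -> M < phi t ->
  exists2 s, 0 <= s < t & phi s = M /\ forall r, s < r <= t -> M < phi r.
Proof.
move=> phic phi0 t01 Mt.
have /andP[t0 t1] : 0 < t < 1 by move: t01; rewrite in_itv.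
have sub : `[0, t] `<=` `[0, 1].
  by apply: subset_itvl; rewrite bnd_simp ltW.
have phit := continuous_subspaceW sub phic.
pose A := [set s | phi s <= M] `&` `[0, t].
have cA : compact A.
  have /closed_subspaceP[B cB BA] : closed ([set s | phi s <= M] : set (subspace `[0, t])).
    exact: ((@continuous_closedP (subspace `[0, t]) R phi).1 phit _ (@closed_le R M)).
  have cBt : closed (B `&` `[0, t]) by apply: closedI => //; exact: interval_closed.
  have sBt : B `&` `[0, t] `<=` `[0, t] by move=> r [].
  by rewrite /A -BA; exact: subclosed_compact cBt (@segment_compact R 0 t) sBt.
have A0 : A !=set0 by exists 0; split => //=; rewrite in_itv/= lexx ltW.
have idc : {within A, continuous (id : R -> R)}.
  by apply: continuous_subspaceT => r; exact: cvg_id.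
have [s sA smax] := compact_EVT_max A0 cA idc.
have [sM] : A s by rewrite -inE.
rewrite /= in_itv/= => /andP[s0 st].
have st' : s < t.
  by rewrite lt_neqAle st andbT; apply/eqP => e; move: Mt; rewrite -e ltNge sM.
have gtM r : s < r <= t -> M < phi r.
  move=> /andP[sr rt]; rewrite ltNge; apply/negP => rM.
  suff /smax : r \in A by rewrite leNgt sr.
  by rewrite inE; split => //=; rewrite in_itv/= rt (le_trans s0)// ltW.
exists s; first by rewrite s0.
split => //; apply/eqP; rewrite eq_le sM /= leNgt; apply/negP => sltM.
have sub' : `[s, t] `<=` `[0, t] by apply: subset_itvr; rewrite bnd_simp.
have phis := continuous_subspaceW sub' phit.
(* If phi s < M, the value M would be attained at some c in [s, t]: c > s contradicts the choice of
   s, and c = s the strict inequality. *)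
have [|c] := IVT st phis (v := M).
  by rewrite ge_min (ltW sltM)/= le_max (ltW Mt) orbT.
rewrite in_itv/= => /andP[sc ct] e.
have [sc'|cs|ec] := ltgtP s c.
- by have := gtM c; rewrite sc' ct e ltxx => /(_ isT).
- by move: sc; rewrite leNgt cs.
- by move: sltM; rewrite ec e ltxx.
Qed.

Lemma derive0_cst L s t : {within `[0, 1], continuous L} ->
  0 <= s -> s <= t -> t <= 1 ->
  (forall r, r \in `]s, t[ -> is_derive r (1 : R) L 0) -> L t = L s.
Proof.
move=> Lc s0 st t1 dL.
have sub : `[s, t] `<=` `[0, 1].
  move=> r /=; rewrite !in_itv/= => /andP[sr rt].
  by rewrite (le_trans s0 sr) (le_trans rt t1).
have Lc' := continuous_subspaceW sub Lc.
have [c _ e] := MVT_segment st dL Lc'.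
by apply/eqP; rewrite -subr_eq0 e mul0r.
Qed.

End dynamics.

(** * Coordinates and the Hamiltonian vector field *)

Section coordinates.
Context {R : realType}.

(** The coordinates are named so that a linear structure can be attached to them; their derivatives
    and smoothness then come from the general facts on linear maps. *)
Definition qcoord (i : 'I_2) (x : phase R) : R := x.1 0 i.
Definition pcoord (i : 'I_2) (x : phase R) : R := x.2 0 i.
Definition coord (i : 'I_2) (q : plane R) : R := q 0 i.

Fact qcoord_linear i : linear (qcoord i : phase R -> R^o).
Proof. by move=> a x y; rewrite /qcoord/= !mxE. Qed.
HB.instance Definition _ i :=
  GRing.isLinear.Build R (phase R) R^o _ (qcoord i) (qcoord_linear i).

Fact pcoord_linear i : linear (pcoord i : phase R -> R^o).
Proof. by move=> a x y; rewrite /pcoord/= !mxE. Qed.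
HB.instance Definition _ i :=
  GRing.isLinear.Build R (phase R) R^o _ (pcoord i) (pcoord_linear i).

Fact coord_linear i : linear (coord i : plane R -> R^o).
Proof. by move=> a x y; rewrite /coord/= !mxE. Qed.
HB.instance Definition _ i :=
  GRing.isLinear.Build R (plane R) R^o _ (coord i) (coord_linear i).

Lemma continuous_coord i : continuous (coord i).
Proof. exact: coord_continuous. Qed.

Lemma continuous_fst : continuous (fst : phase R -> plane R).
Proof. by move=> x; exact: cvg_fst. Qed.

Lemma continuous_snd : continuous (snd : phase R -> plane R).
Proof. by move=> x; exact: cvg_snd. Qed.

Lemma continuous_qcoord i : continuous (qcoord i).
Proof.
move=> x; have h : {for x.1, continuous (coord i)} by exact: continuous_coord.
have -> : qcoord i = coord i \o fst by [].
exact: (continuous_comp (@continuous_fst x) h).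
Qed.

Lemma continuous_pcoord i : continuous (pcoord i).
Proof.
move=> x; have h : {for x.2, continuous (coord i)} by exact: continuous_coord.
have -> : pcoord i = coord i \o snd by [].
exact: (continuous_comp (@continuous_snd x) h).
Qed.

Lemma is_derive_linear {E : normedModType R} (l : {linear E -> R^o}) x v :
  continuous l -> is_derive x v (l : E -> R) (l v).
Proof.
move=> lc; have ld : differentiable l x by exact: linear_differentiable.
by apply: DeriveDef; [exact: diff_derivable|rewrite deriveE// diff_lin].
Qed.

Lemma is_derive_coord i (q v : plane R) : is_derive q v (coord i) (coord i v).
Proof. by apply: is_derive_linear; exact: continuous_coord. Qed.

Lemma is_derive_qcoord i (x v : phase R) : is_derive x v (qcoord i) (qcoord i v).
Proof. by apply: is_derive_linear; exact: continuous_qcoord. Qed.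

Lemma is_derive_pcoord i (x v : phase R) : is_derive x v (pcoord i) (pcoord i v).
Proof. by apply: is_derive_linear; exact: continuous_pcoord. Qed.

Definition dot (q v : plane R) : R := q 0 0 * v 0 0 + q 0 1 * v 0 1.
Definition nsq (q : plane R) : R := dot q q.

Lemma nsqE q : nsq q = q 0 0 ^+ 2 + q 0 1 ^+ 2.
Proof. by []. Qed.

Lemma nsq_ge0 q : 0 <= nsq q.
Proof. by rewrite nsqE addr_ge0 ?sqr_ge0. Qed.

Lemma I2E (i : 'I_2) : i = 0 \/ i = 1.
Proof. by case: i => -[|[|//]] i2; [left|right]; exact: val_inj. Qed.

Lemma sum_I2 (f : 'I_2 -> R) : \sum_(i < 2) f i = f 0 + f 1.
Proof. by rewrite big_ord_recl big_ord1; congr (_ + f _); exact: val_inj. Qed.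

Lemma enormE q : enorm q = Num.sqrt (nsq q).
Proof. by rewrite /enorm sum_I2. Qed.

Lemma is_derive_nsq (q v : plane R) : is_derive q v nsq (2 * dot q v).
Proof.
have h := is_deriveD (is_deriveM (is_derive_coord 0 q v) (is_derive_coord 0 q v))
  (is_deriveM (is_derive_coord 1 q v) (is_derive_coord 1 q v)).
by apply: is_derive_eq h _; rewrite -![_ *: _]/(_ * _) /dot /coord; ring.
Qed.

Lemma Ck_nsq n : Ck n nsq.
Proof.
have h i : Ck n (coord i) by apply: Ck_linear; exact: continuous_coord.
exact: (CkD (CkM (h 0) (h 0)) (CkM (h 1) (h 1))).
Qed.

Lemma row2E (v : plane R) :
  v = v 0 0 *: delta_mx 0 0 + v 0 1 *: delta_mx 0 1.
Proof.
by apply/rowP => i; rewrite !mxE/=; case: (I2E i) => -> /=;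
  rewrite ?(mulr1, mulr0, addr0, add0r).
Qed.

Lemma derive_row2 (W : plane R -> R) q v : differentiable W q ->
  'D_v W q = v 0 0 * 'D_(delta_mx 0 0) W q + v 0 1 * 'D_(delta_mx 0 1) W q.
Proof.
by move=> Wd; rewrite !deriveE// [in LHS](row2E v) linearD !linearZ.
Qed.

(** The quarter turn, which as a vector field is the angular field d/dtheta. *)
Definition rot (q : plane R) : plane R := \row_i (if i == 0 then - q 0 1 else q 0 0).

(** The Hamiltonian vector field of H0(q, p) - W(q), written out in coordinates. *)
Definition rotating_field (W : plane R -> R) (x : phase R) : phase R :=
  (\row_i (if i == 0 then x.2 0 0 + x.1 0 1 else x.2 0 1 - x.1 0 0),
   \row_i (if i == 0 then x.2 0 1 + 'D_(delta_mx 0 0) W x.1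
           else - x.2 0 0 + 'D_(delta_mx 0 1) W x.1)).

Lemma is_derive_H0 (x v : phase R) : is_derive x v H0
  (dot x.2 v.2 + v.2 0 0 * x.1 0 1 + x.2 0 0 * v.1 0 1
   - v.2 0 1 * x.1 0 0 - x.2 0 1 * v.1 0 0).
Proof.
have p i := is_derive_pcoord i x v; have q i := is_derive_qcoord i x v.
have h := is_deriveB (is_deriveD
  (is_deriveZ 2^-1 (is_deriveD (is_deriveM (p 0) (p 0)) (is_deriveM (p 1) (p 1))))
  (is_deriveM (p 0) (q 1))) (is_deriveM (p 1) (q 0)).
apply: is_derive_eq h _.
rewrite -![_ *: _]/(_ * _) /dot /pcoord /qcoord.
by move: (x.2) (x.1) (v.2) (v.1) => a b c d; field.
Qed.

End coordinates.

(** * Motion of the radius and of the angular momentum *)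

Section motion.
Context {R : realType}.
Implicit Types (W : plane R -> R) (F g : phase R -> R) (x : phase R).

(** Only the first derivatives of g at the single point x enter, so g may depend on p elsewhere.
    This is what allows a cutoff in the momentum. *)
Lemma ham_vf_H0B g W x : (forall v, is_derive x v g ('D_(v.1) W x.1)) ->
  ham_vf (fun y => H0 y - g y) x = rotating_field W x.
Proof.
move=> gd; have d v := is_deriveB (is_derive_H0 x v) (gd v).
have e v : 'D_v (fun y => H0 y - g y) x = _ := @derive_val _ _ _ _ _ _ _ (d v).
congr pair; apply/rowP => i; rewrite !mxE /d_dp /d_dq e /dot /= !mxE.
  by rewrite derive0; case: (I2E i) => -> /=; ring.
by case: (I2E i) => -> /=; ring.
Qed.

Definition ang x : R := x.2 0 1 * x.1 0 0 - x.2 0 0 * x.1 0 1.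

Lemma H0E x : H0 x = 2^-1 * nsq x.2 - ang x.
Proof. by rewrite /H0 /ang /nsq /dot -!expr2 opprB addrA. Qed.

Lemma Ck_qcoord n i : Ck n (@qcoord R i).
Proof. by apply: Ck_linear; exact: continuous_qcoord. Qed.

Lemma Ck_pcoord n i : Ck n (@pcoord R i).
Proof. by apply: Ck_linear; exact: continuous_pcoord. Qed.

Lemma Ck_fst n W : Ck n W -> Ck n (fun x => W x.1).
Proof. by apply: (Ck_comp_linear (l := fst)); exact: continuous_fst. Qed.

Lemma Ck_snd n W : Ck n W -> Ck n (fun x => W x.2).
Proof. by apply: (Ck_comp_linear (l := snd)); exact: continuous_snd. Qed.

Lemma Ck_ang n : Ck n ang.
Proof.
have -> : ang = (pcoord 1 \* qcoord 0) \+ (cst (- 1) \* (pcoord 0 \* qcoord 1)).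
  by apply/funext => x; rewrite /ang /= mulN1r.
have [q p] := (Ck_qcoord n, Ck_pcoord n).
by apply: CkD; [|apply: CkM; first exact: Ck_cst]; apply: CkM.
Qed.

Lemma smooth_H0B g : smooth g -> smooth (fun x => H0 x - g x).
Proof.
move=> gs n.
have -> : (fun x => H0 x - g x) = (cst 2^-1 \* (fun x => nsq x.2)) \+
    (cst (- 1) \* (ang \+ g)).
  by apply/funext => x; rewrite H0E /=; ring.
apply: CkD; apply: CkM; try exact: Ck_cst.
  by apply: Ck_snd; exact: Ck_nsq.
by apply: CkD; [exact: Ck_ang|exact: gs].
Qed.

(** A critical point stays in the zero set of F, where the two fields coincide. The field of F is
    continuous, so the equation holds classically in the open interval. *)
Lemma crit_motion F W q0 q1 v eta : smooth F ->
  (forall x, F x = 0 -> ham_vf F x = rotating_field W x) ->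
  Crit q0 q1 F (v, eta) ->
  forall t : R, t \in `]0, 1[ -> forall i,
    is_derive t (1 : R) (fun s => (v s).1 0 i) (eta * (rotating_field W (v t)).1 0 i) /\
    is_derive t (1 : R) (fun s => (v s).2 0 i) (eta * (rotating_field W (v t)).2 0 i).
Proof.
move=> Fs FW [[Wv _ _] vF F0] t t01 i.
have Fq u : continuous ('D_u F) by have [_] := Ck_succ (Fs 1%N); exact.
have Yq j : continuous (fun x => (eta *: ham_vf F x).1 0 j).
  have -> : (fun x => (eta *: ham_vf F x).1 0 j) =
      cst eta \* 'D_((0, delta_mx 0 j) : phase R) F.
    by apply/funext => x; rewrite /= !mxE.
  by move=> x; apply: cvgM; [exact: cvg_cst|exact: Fq].
have Yp j : continuous (fun x => (eta *: ham_vf F x).2 0 j).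
  have -> : (fun x => (eta *: ham_vf F x).2 0 j) =
      cst (- eta) \* 'D_((delta_mx 0 j, 0) : phase R) F.
    by apply/funext => x; rewrite /= !mxE mulrN mulNr.
  by move=> x; apply: cvgM; [exact: cvg_cst|exact: Fq].
have [dq dp] := W12_is_derive (Y := fun x => eta *: ham_vf F x) Wv Yq Yp vF t01 i.
have Ft : F (v t) = 0 by apply: F0; exact: subset_itv_oo_cc.
by rewrite -(FW _ Ft); move: dq dp; rewrite /= !mxE.
Qed.

(** The terms p_1 q_2 - p_2 q_1 of H0 generate simultaneous rotations of q and p, which preserve
    |q|^2, q . p and the angular momentum. What remains comes from |p|^2/2 and W. *)
Lemma nsq_motion F W q0 q1 v eta : smooth F -> smooth W ->
  (forall x, F x = 0 -> ham_vf F x = rotating_field W x) ->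
  Crit q0 q1 F (v, eta) ->
  forall t : R, t \in `]0, 1[ ->
    [/\ is_derive t (1 : R) (fun s => nsq (v s).1) (2 * eta * dot (v t).1 (v t).2),
        is_derive t (1 : R) (fun s => 2 * eta * dot (v s).1 (v s).2)
          (2 * eta ^+ 2 * (nsq (v t).2 + 'D_((v t).1) W (v t).1)) &
        is_derive t (1 : R) (ang \o v) (eta * 'D_(rot (v t).1) W (v t).1)].
Proof.
move=> Fs Ws FW C t t01.
have d := crit_motion Fs FW C t01.
have Wd : differentiable W (v t).1 by have [] := Ck_succ (Ws 1%N).
have [[q0d p0d] [q1d p1d]] := (d 0, d 1).
split.
- have h := is_deriveD (is_deriveM q0d q0d) (is_deriveM q1d q1d).
  apply: is_derive_eq h _; rewrite -![_ *: _]/(_ * _) !mxE /dot /=; ring.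
- have h := is_deriveZ (2 * eta) (is_deriveD (is_deriveM q0d p0d) (is_deriveM q1d p1d)).
  apply: is_derive_eq h _.
  by rewrite (derive_row2 _ Wd) -![_ *: _]/(_ * _) !mxE /nsq /dot /=; ring.
- have h := is_deriveB (is_deriveM p1d q0d) (is_deriveM p0d q1d).
  apply: is_derive_eq h _.
  by rewrite (derive_row2 _ Wd) -![_ *: _]/(_ * _) !mxE /=; ring.
Qed.

End motion.

(** * Confinement of critical points *)

Section confinement.
Context {R : realType}.
Implicit Types (W : plane R -> R) (F g : phase R -> R) (x : phase R).

Lemma continuous_along_path (v : R -> phase R) g : W12 v -> continuous g ->
  {within `[0, 1], continuous (fun s => g (v s))}.
Proof.
by move=> /W12_continuous vc gc s; exact: (continuous_comp (vc s) (gc (v s))).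
Qed.

Lemma continuous_nsq_fst : continuous (fun x => nsq x.1 : R).
Proof. exact: (Ck_fst (Ck_nsq 0)). Qed.

Lemma endpoint_nsq F q0 q1 v eta M : Crit q0 q1 F (v, eta) ->
  nsq q0 <= M -> nsq q1 <= M ->
  [/\ W12 v, {within `[0, 1], continuous (fun s => nsq (v s).1)},
     nsq (v 0).1 <= M & nsq (v 1).1 <= M].
Proof.
move=> [[Wv v0 v1] _ _] M0 M1; split; rewrite ?v0 ?v1//.
exact: (continuous_along_path Wv continuous_nsq_fst).
Qed.

Lemma confinement F W q0 q1 v eta M : smooth F -> smooth W ->
  (forall x, F x = 0 -> ham_vf F x = rotating_field W x) ->
  Crit q0 q1 F (v, eta) -> nsq q0 <= M -> nsq q1 <= M ->
  (forall t, t \in `]0, 1[ -> M < nsq (v t).1 ->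
     0 < nsq (v t).2 + 'D_((v t).1) W (v t).1) ->
  forall t, t \in `[0, 1] -> nsq (v t).1 <= M.
Proof.
move=> Fs Ws FW C M0 M1 conv.
have [Wv phic e0 e1] := endpoint_nsq C M0 M1.
have d := nsq_motion Fs Ws FW C.
(* For eta = 0 the factor eta^2 removes strict convexity, but then |q|^2 is constant. *)
have [eta0|eta0] := eqVneq eta 0.
  move=> t; rewrite in_itv/= => /andP[t0 t1].
  have h (r : R) : r \in `]0, t[ -> is_derive r (1 : R) (fun s => nsq (v s).1) 0.
    rewrite in_itv/= => /andP[r0 rt].
    have r01 : r \in `]0, 1[ by rewrite in_itv/= r0 (lt_le_trans rt).
    by have [h _ _] := d r r01; apply: is_derive_eq h _; rewrite eta0 mulr0 mul0r.
  by rewrite (derive0_cst phic (lexx 0) t0 t1 h).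
have d1 (t : R) (t01 : t \in `]0, 1[) := let: And3 h _ _ := d t t01 in h.
have d2 (t : R) (t01 : t \in `]0, 1[) := let: And3 _ h _ := d t t01 in h.
apply: (max_principle phic d1 d2 e0 e1) => t t01 /(conv t t01).
by apply: mulr_gt0; apply: mulr_gt0 => //; rewrite exprn_even_gt0.
Qed.

(** Going back from t to the last time s with |q|^2 = M, the path stays where W is invariant under
    rotation, so the angular momentum does not change. *)
Lemma ang_conserved F W q0 q1 v eta M : smooth F -> smooth W ->
  (forall x, F x = 0 -> ham_vf F x = rotating_field W x) ->
  Crit q0 q1 F (v, eta) -> nsq q0 <= M -> nsq q1 <= M ->
  (forall q, M <= nsq q -> 'D_(rot q) W q = 0) ->
  forall t, t \in `]0, 1[ -> M < nsq (v t).1 ->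
  exists s, [/\ s \in `[0, 1], nsq (v s).1 = M & ang (v s) = ang (v t)].
Proof.
move=> Fs Ws FW C M0 M1 Wrot t t01 Mt.
have [Wv phic e0 e1] := endpoint_nsq C M0 M1.
have [s /andP[s0 st] [sM gtM]] := last_crossing phic e0 t01 Mt.
have /andP[t0 t1] : 0 < t < 1 by move: t01; rewrite in_itv.
exists s; split => //.
  by rewrite in_itv/= s0 (le_trans (ltW st) (ltW t1)).
have angc := continuous_along_path Wv (Ck_ang 0).
have d (r : R) : r \in `]s, t[ -> is_derive r (1 : R) (ang \o v) 0.
  rewrite in_itv/= => /andP[sr rt].
  have r01 : r \in `]0, 1[ by rewrite in_itv/= (le_lt_trans s0 sr) (lt_trans rt t1).
  have [_ _ h] := nsq_motion Fs Ws FW C r01.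
  by apply: is_derive_eq h _; rewrite Wrot ?mulr0// ltW// gtM// sr ltW.
exact/esym/(derive0_cst angc s0 (ltW st) (ltW t1) d).
Qed.

End confinement.

(** * Estimates on the cutoff and on the energy *)

Section estimates.
Context {R : realType}.
Implicit Types (a c r : R) (x : phase R).

Lemma ang_sqr_le x : ang x ^+ 2 <= nsq x.1 * nsq x.2.
Proof.
rewrite -subr_ge0.
have -> : nsq x.1 * nsq x.2 - ang x ^+ 2 = dot x.1 x.2 ^+ 2.
  by rewrite /nsq /dot /ang; ring.
exact: sqr_ge0.
Qed.

(** The interval [r0^2, 4 r0^2] has length 3 r0^2, so |X'| <= 3 / (8 r0^2), and only r between r0
    and 2 r0 needs work. There the slope bound gives X - r^2 X' <= 3/2, because the r^2 terms
    cancel; multiplying by r < 2 r0 yields 3 r0. *)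
Lemma step_estimate (X X' : R -> R) r0 r : 0 < r0 -> 0 <= r ->
  step (r0 ^+ 2) (4 * r0 ^+ 2) X X' ->
  r * - X' (r ^+ 2) <= 3 / (4 * r0) /\
  r * (X (r ^+ 2) - r ^+ 2 * X' (r ^+ 2)) <= 3 * r0.
Proof.
move=> r0p rp st.
have q0 : 0 <= 3 / (4 * r0) by rewrite divr_ge0// mulr_ge0// ltW.
have [rr|rr] := leP r r0.
  have [->->] : X (r ^+ 2) = 1 /\ X' (r ^+ 2) = 0.
    by apply: (step_one st); rewrite lerXn2r// nnegrE// ltW.
  by rewrite oppr0 !mulr0; split => //; lra.
have [rr'|rr'] := leP (2 * r0) r.
  have [->->] : X (r ^+ 2) = 0 /\ X' (r ^+ 2) = 0.
    by apply: (step_zero st); nra.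
  by rewrite oppr0 !mulr0 subr0 mulr0; split => //; lra.
have r2 : 0 < r0 ^+ 2 by rewrite exprn_gt0.
have sl t : 0 <= - X' t <= 3 / (8 * r0 ^+ 2).
  have /andP[s1 s2] := step_slope st t; rewrite oppr_ge0 s2/= -lerN2 opprK.
  apply: le_trans s1; have -> : 4 * r0 ^+ 2 - r0 ^+ 2 = 3 * r0 ^+ 2 by ring.
  by rewrite le_eqVlt; apply/orP; left; apply/eqP; field; rewrite gt_eqF.
have rho : r ^+ 2 <= 4 * r0 ^+ 2 by nra.
(* Mean value theorem from the far end 4 r0^2 of the step, where X vanishes. *)
have Xb : X (r ^+ 2) <= 3 / (8 * r0 ^+ 2) * (4 * r0 ^+ 2 - r ^+ 2).
  have [b _] := mvt_global (step_derive st) rho.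
  have [-> _] := step_zero st (lexx _).
  rewrite sub0r => /eqP; rewrite eqr_oppLR => /eqP ->; rewrite -mulNr.
  by rewrite ler_wpM2r ?subr_ge0//; have /andP[] := sl b.
have /andP[s0 s1] := sl (r ^+ 2).
split.
  apply: le_trans (ler_wpM2l rp s1) _.
  apply: le_trans (ler_wpM2r _ (ltW rr')) _; first by rewrite divr_ge0// mulr_ge0// ltW.
  by rewrite le_eqVlt; apply/orP; left; apply/eqP; field; rewrite gt_eqF.
have E : X (r ^+ 2) - r ^+ 2 * X' (r ^+ 2) <= 3 / 2.
  have h := ler_wpM2l (sqr_ge0 r) s1.
  have e : 3 / 2 = 3 / (8 * r0 ^+ 2) * (4 * r0 ^+ 2 - r ^+ 2)
      + r ^+ 2 * (3 / (8 * r0 ^+ 2)).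
    by field; rewrite gt_eqF.
  by rewrite e -mulrN; exact: lerD.
apply: le_trans (ler_wpM2l rp E) _; lra.
Qed.

(* Young's inequality with weight 3/8, close to the ratio of b and y in the
   worst case R1 = 0. *)
Lemma energy_threshold (a R1 m c r0 b y : R) : 0 < R1 -> 0 < m -> m ^+ 3 = 2 * a ->
  0 < c -> 4 * a * (3 * R1 + 2 * m) < c ^+ 2 -> r0 = R1 + 2 / 3 * m ->
  b <= 3 / 4 * a / r0 -> 0 <= y -> y ^+ 2 <= 6 * a * r0 -> c <= b + y -> False.
Proof.
move=> R10 m0 ma c0 cl r0E bl y0 yl cb.
have r00 : 0 < r0 by rewrite r0E; nra.
have aE : a = m ^+ 3 / 2 by rewrite ma; field.
have B : b <= 9 / 16 * m ^+ 2.
  apply: le_trans bl _; rewrite ler_pdivrMr// aE r0E.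
  have : 0 <= m ^+ 2 * R1 by rewrite mulr_ge0 ?sqr_ge0// ltW.
  by rewrite !exprS !expr0; lra.
have Y : y ^+ 2 <= 3 * m ^+ 3 * R1 + 2 * m ^+ 4.
  by apply: le_trans yl _; rewrite aE r0E le_eqVlt; apply/orP; left; apply/eqP; field.
pose B0 := 9 / 16 * m ^+ 2; rewrite -/B0 in B.
have cB : c <= B0 + y by lra.
have c2 : c ^+ 2 <= (B0 + y) ^+ 2 by rewrite lerXn2r// nnegrE; lra.
have yg : (B0 + y) ^+ 2 <= 11 / 8 * y ^+ 2 + 11 / 3 * B0 ^+ 2.
  have := sqr_ge0 (3 * y - 8 * B0); rewrite !expr2; lra.
have B4 : B0 ^+ 2 = 81 / 256 * m ^+ 4 by rewrite /B0; field.
have m3 : 0 <= m ^+ 3 * R1 by rewrite mulr_ge0 ?exprn_ge0 ?ltW.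
have m4 : 0 <= m ^+ 4 by rewrite exprn_ge0 ?ltW.
(* The coefficients now compare: 33/8 < 6 for m^3 R1, and 11/4 + 297/256 < 4 for m^4. *)
have cE : 4 * a * (3 * R1 + 2 * m) = 6 * (m ^+ 3 * R1) + 4 * m ^+ 4 by rewrite aE; field.
rewrite cE in cl; lra.
Qed.

End estimates.

(** * The potential in polar coordinates *)

Section polar_coordinates.
Context {R : realType}.
Implicit Types (V : plane R -> R) (q : plane R) (r theta : R).

Lemma polarZ r theta : polar r theta = r *: polar 1 theta.
Proof. by apply/rowP => i; rewrite !mxE; case: ifP => _; rewrite mul1r. Qed.

Lemma polar_surj q : exists theta, q = polar (Num.sqrt (nsq q)) theta.
Proof.
have [q0|q0] := eqVneq (nsq q) 0.
  exists 0; rewrite q0 sqrtr0 polarZ scale0r.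
  move/eqP: q0; rewrite nsqE paddr_eq0 ?sqr_ge0// !sqrf_eq0 => /andP[/eqP q0 /eqP q1].
  by apply/rowP => i; rewrite mxE; case: (I2E i) => ->.
set r := Num.sqrt (nsq q).
have r0 : 0 < r by rewrite sqrtr_gt0 lt_neqAle eq_sym q0 nsq_ge0.
have r2 : r ^+ 2 = q 0 0 ^+ 2 + q 0 1 ^+ 2 by rewrite sqr_sqrtr ?nsq_ge0// nsqE.
pose x := q 0 0 / r; pose y := q 0 1 / r.
have xy : x ^+ 2 + y ^+ 2 = 1.
  by rewrite /x /y !exprMn -mulrDl -r2 exprVn divff// gt_eqF// exprn_gt0.
have x1 : -1 <= x <= 1.
  by have y2 := sqr_ge0 y; apply/andP; split; nra.
have sx : sin (acos x) = `|y|.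
  by rewrite sin_acos// -xy addrAC subrr add0r sqrtr_sqr.
have cx : cos (acos x) = x by rewrite acosK// in_itv/=.
have qx : q 0 0 = r * x by rewrite /x mulrCA divff ?mulr1// gt_eqF.
have qy : q 0 1 = r * y by rewrite /y mulrCA divff ?mulr1// gt_eqF.
have [y0|y0] := leP 0 y.
  exists (acos x); apply/rowP => i; rewrite !mxE; case: (I2E i) => -> /=.
    by rewrite cx.
  by rewrite sx ger0_norm.
exists (- acos x); apply/rowP => i; rewrite !mxE; case: (I2E i) => -> /=.
  by rewrite cosN cx.
by rewrite sinN sx ltr0_norm// opprK.
Qed.

(** The ray is affine in r with velocity [polar 1 theta], so both sides are limits of the same
    difference quotient. *)
Lemma dpolar_rE V r theta :
  dpolar_r V r theta = 'D_(polar 1 theta) V (polar r theta).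
Proof.
rewrite /dpolar_r derive1E /derive; set f := (fun h => _); set g := (fun h => _).
suff -> : f = g by [].
apply/funext => h; rewrite /f /g /=; congr (_ *: (V _ - _)).
by rewrite polarZ scalerDl [h *: 1]mulr1 -(polarZ r).
Qed.

Lemma dpolar_thetaE V r theta : differentiable V (polar r theta) ->
  dpolar_theta V r theta = 'D_(rot (polar r theta)) V (polar r theta).
Proof.
move=> Vd; rewrite /dpolar_theta derive1E.
have dc i j : is_derive theta (1 : R) (fun t => polar r t i j) (rot (polar r theta) i j).
  rewrite (ord1 i); case: (I2E j) => ->.
    have -> : (fun t => polar r t 0 0) = r \*: cos by apply/funext => t; rewrite !mxE.
    apply: is_derive_eq (is_deriveZ r (is_derive_cos theta)) _.
    by rewrite !mxE/= -[_ *: _]/(_ * _) mulrN.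
  have -> : (fun t => polar r t 0 1) = r \*: sin by apply/funext => t; rewrite !mxE.
  apply: is_derive_eq (is_deriveZ r (is_derive_sin theta)) _.
  by rewrite !mxE/= -[_ *: _]/(_ * _).
have pd : derivable (polar r) theta 1.
  by apply/derivable_mxP => i j; have [] := dc i j.
have pd' : differentiable (polar r) theta by exact/derivable1_diffP.
have Vpd : differentiable (V \o polar r) theta by exact: differentiable_comp.
rewrite (deriveE _ Vpd) (diff_comp pd' Vd) /= (deriveE _ Vd) -(deriveE _ pd').
congr ('d V _ _); rewrite derive_mx//; apply/matrixP => i j; rewrite mxE.
by have [_ ->] := dc i j.
Qed.

End polar_coordinates.

(** * Cartesian form of the hypotheses on V *)

Section potential.
Context {R : realType}.
Variables (R1 a : R) (V : plane R -> R).
Hypotheses (R1_gt0 : 0 < R1) (a_gt0 : 0 < a) (V_smooth : smooth V).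
Implicit Types (q : plane R).

Lemma differentiable_potential q : differentiable V q.
Proof. by have [] := Ck_succ (V_smooth 1%N). Qed.

Lemma sqrt_gt q : R1 ^+ 2 < nsq q -> R1 < Num.sqrt (nsq q).
Proof.
move=> h; rewrite -[ltLHS]ger0_norm ?ltW// -sqrtr_sqr ltr_sqrt//.
by apply: le_lt_trans h; exact: sqr_ge0.
Qed.

Hypothesis V_le : forall r theta : R, R1 < r -> V (polar r theta) <= a / r.

Lemma potential_le q : R1 ^+ 2 < nsq q -> V q <= a / Num.sqrt (nsq q).
Proof.
by move=> /sqrt_gt h; have [theta qE] := polar_surj q; rewrite {1}qE; exact: V_le.
Qed.

(** The decay of V is assumed only for r > R1. It extends to the circle by continuity along the ray
    through q, approached from outside. *)
Lemma potential_le_boundary q : nsq q = R1 ^+ 2 -> V q <= a / R1.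
Proof.
move=> qR; rewrite leNgt; apply/negP => Vq.
have Vc : continuous V by exact: (V_smooth 0%N).
have sc : (fun s : R => V (s *: q)) @ (1 : R) --> V q.
  rewrite -{2}[q]scale1r; apply: (@cvg_comp _ _ _ (fun s : R => s *: q) V).
    by apply: cvgZr_tmp; exact: cvg_id.
  exact: Vc.
have := cvgr_gt _ sc _ Vq => -[d /= d0 H].
have := H (1 + d / 2); rewrite /ball /= opprD addrA subrr sub0r normrN gtr0_norm ?divr_gt0//.
have d2 : d / 2 < d by lra.
move=> /(_ d2); set s := 1 + d / 2; have s1 : 1 < s by rewrite ltrDl divr_gt0.
have [theta qE] := polar_surj q.
move: qE; rewrite qR sqrtr_sqr gtr0_norm// polarZ => ->.
rewrite scalerA -polarZ ltNge => /negP; apply.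
have sR : R1 < s * R1 by rewrite ltr_pMl.
apply: le_trans (V_le _ sR) _.
by rewrite ler_pM2l// lef_pV2 ?posrE ?(ltW sR)// (lt_trans R1_gt0).
Qed.

(** The derivative of V in direction q is r dV/dr; the assumed inequality is multiplied by r. *)
Lemma potential_radial q :
  (forall r theta : R, R1 < r ->
     0 <= dpolar_r V r theta + 2 / r * V (polar r theta)) ->
  R1 ^+ 2 < nsq q -> 0 <= 'D_q V q + 2 * V q.
Proof.
move=> V_dr /sqrt_gt; have [theta qE] := polar_surj q.
move: qE; set r := Num.sqrt _ => -> Rr; have r0 := lt_trans R1_gt0 Rr.
have Vd := differentiable_potential (polar r theta).
have e P : differentiable V P -> 'D_(polar r theta) V P = r * 'D_(polar 1 theta) V P.
  by move=> Pd; rewrite !(deriveE _ Pd) (polarZ r) linearZ.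
have := V_dr r theta Rr; rewrite dpolar_rE e// -(pmulr_rge0 _ r0) mulrDr.
rewrite [r * (_ * _)]mulrA [r * (_ / _)]mulrCA divff ?mulr1//.
by rewrite gt_eqF.
Qed.

Lemma potential_angular q :
  (forall r theta : R, R1 <= r -> dpolar_theta V r theta = 0) ->
  R1 ^+ 2 <= nsq q -> 'D_(rot q) V q = 0.
Proof.
move=> V_dt qR; have [theta qE] := polar_surj q.
have Rr : R1 <= Num.sqrt (nsq q).
  by have := ler_wsqrtr qR; rewrite sqrtr_sqr ger0_norm// ltW.
by rewrite qE -dpolar_thetaE ?V_dt//; exact: differentiable_potential.
Qed.

End potential.

(** * The truncated potential *)

Section cutoff.
Context {R : realType}.
Implicit Types (V : plane R -> R) (X Y : R -> R) (q v : plane R) (x : phase R).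

(** The cutoff acts on |q|^2 rather than |q|, which keeps it smooth at the origin. *)
Definition radial_cut V X q : R := V q * X (nsq q).

(** This is the function h whose existence the theorem claims. *)
Definition phase_cut V X Y (c : R) x : R := radial_cut V X x.1 * Y (nsq x.2) + c.

Lemma smooth_radial_cut V X : smooth V -> smooth X -> smooth (radial_cut V X).
Proof.
by move=> Vs Xs n; apply: CkM; [exact: Vs|apply: Ck_comp; [exact: Xs|exact: Ck_nsq]].
Qed.

Lemma smooth_phase_cut V X Y c : smooth V -> smooth X -> smooth Y ->
  smooth (phase_cut V X Y c).
Proof.
move=> Vs Xs Ys n; apply: CkD; last exact: Ck_cst.
apply: CkM; first exact: Ck_fst (smooth_radial_cut Vs Xs n).
by apply: (@Ck_snd _ _ (Y \o nsq)); apply: Ck_comp; [exact: Ys|exact: Ck_nsq].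
Qed.

Lemma is_derive_comp_nsq X (X' : R) q v : is_derive (nsq q) (1 : R) X X' ->
  is_derive q v (fun u => X (nsq u)) (X' * (2 * dot q v)).
Proof.
move=> [Xd XE]; have nd : differentiable nsq q.
  by have [] := Ck_succ (@Ck_nsq R 1).
have Xd' : differentiable X (nsq q) by exact/derivable1_diffP.
have cd : differentiable (X \o nsq) q by exact: differentiable_comp.
apply: DeriveDef; first exact: diff_derivable.
rewrite [LHS](derive_comp v Xd' nd) XE; congr (_ * _).
by have [_ ->] := is_derive_nsq q v.
Qed.

Lemma is_derive_radial_cut V X X' q v : smooth V ->
  (forall t, is_derive t (1 : R) X (X' t)) ->
  is_derive q v (radial_cut V X)
    (X (nsq q) * 'D_v V q + V q * (X' (nsq q) * (2 * dot q v))).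
Proof.
move=> Vs Xd; have Vd : is_derive q v V ('D_v V q).
  apply: derivableP; apply: diff_derivable.
  by have [] := Ck_succ (Vs 1%N).
have h := is_deriveM Vd (is_derive_comp_nsq v (Xd (nsq q))).
by apply: is_derive_eq h _; rewrite -![_ *: _]/(_ * _) addrC.
Qed.

Lemma is_derive_fst_snd (f g : plane R -> R) (df dg : R) (x v : phase R) :
  smooth f -> smooth g ->
  is_derive x.1 v.1 f df -> is_derive x.2 v.2 g dg ->
  is_derive x v (fun y => f y.1 * g y.2) (f x.1 * dg + g x.2 * df).
Proof.
move=> fs gs [_ fE] [_ gE].
have fd : differentiable f x.1 by have [] := Ck_succ (fs 1%N).
have gd : differentiable g x.2 by have [] := Ck_succ (gs 1%N).
have f1 : is_derive x v (fun y => f y.1) df.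
  apply: DeriveDef.
    by apply: diff_derivable; have [] := Ck_succ (Ck_fst (fs 1%N)).
  by rewrite -fE; apply: (derive_comp_linear (l := fst)) => //; exact: continuous_fst.
have g1 : is_derive x v (fun y => g y.2) dg.
  apply: DeriveDef.
    by apply: diff_derivable; have [] := Ck_succ (Ck_snd (gs 1%N)).
  by rewrite -gE; apply: (derive_comp_linear (l := snd)) => //; exact: continuous_snd.
have h := is_deriveM f1 g1.
by apply: is_derive_eq h _; rewrite -![_ *: _]/(_ * _).
Qed.

Lemma is_derive_phase_cut V X X' Y Y' c (x v : phase R) :
  smooth V -> smooth X -> smooth Y ->
  (forall t, is_derive t (1 : R) X (X' t)) ->
  (forall t, is_derive t (1 : R) Y (Y' t)) ->
  is_derive x v (phase_cut V X Y c)
    (radial_cut V X x.1 * (Y' (nsq x.2) * (2 * dot x.2 v.2))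
     + Y (nsq x.2) * 'D_(v.1) (radial_cut V X) x.1).
Proof.
move=> Vs Xs Ys Xd Yd.
have Us := smooth_radial_cut Vs Xs.
have Ud : is_derive x.1 v.1 (radial_cut V X) ('D_(v.1) (radial_cut V X) x.1).
  apply: derivableP; apply: diff_derivable.
  by have [] := Ck_succ (Us 1%N).
have Ys' : smooth (Y \o nsq).
  by move=> n; apply: Ck_comp; [exact: Ys|exact: Ck_nsq].
have h := is_derive_fst_snd Us Ys' Ud (is_derive_comp_nsq v.2 (Yd (nsq x.2))).
have h' := is_deriveD h (is_derive_cst c x v).
by apply: is_derive_eq h' _; rewrite addr0.
Qed.

Lemma compact_nsq_le (rho : R) : compact [set q : plane R | nsq q <= rho].
Proof.
(* The half-width rho + 1 avoids a square root: y^2 <= rho implies |y| <= rho + 1. *)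
have box := @rV_compact R 2 (fun=> `[- (rho + 1), rho + 1]%classic)
  (fun=> @segment_compact R _ _).
apply: subclosed_compact _ box _.
  apply: (@preimage_closed _ _ (nsq : plane R -> R) [set y | y <= rho]).
    by move=> q _; exact: (Ck_nsq 0).
  exact: closed_le.
move=> q /=; rewrite nsqE => qr i; rewrite in_itv/= -ler_norml.
have h j : q 0 j ^+ 2 <= rho.
  by apply: le_trans qr; case: (I2E j) => ->; rewrite ?lerDl ?lerDr sqr_ge0.
have := h i; rewrite -(real_normK (num_real (q 0 i))).
have := normr_ge0 (q 0 i); move: (`|_|) => y; nra.
Qed.

Lemma potential_bound V (rho : R) : smooth V -> 0 <= rho ->
  exists B, forall q, nsq q <= rho -> V q <= B.
Proof.
move=> Vs rho0.
have [||q _ qmax] := @EVT_max_rV R 2 V _ _ (@compact_nsq_le rho).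
- by exists 0; rewrite /= nsqE !mxE expr0n addr0.
- by apply: continuous_subspaceT; exact: (Vs 0%N).
exists (V q) => u ur; apply: qmax; rewrite inE; exact: ur.
Qed.

(** The differential vanishes outside a product of two closed discs. Since dh(p d/dp) = 2 |p|^2 Y' V
    X <= 0, the last condition follows from h > 0. *)
Lemma admissible_phase_cut V X X' Y Y' (c rho0 rho1 s0 s1 : R) :
  smooth V -> (forall q, 0 <= V q) -> 0 < c ->
  step rho0 rho1 X X' -> step s0 s1 Y Y' -> admissible (phase_cut V X Y c).
Proof.
move=> Vs V0 c0 sX sY.
have cs := smooth_phase_cut c Vs (step_smooth sX) (step_smooth sY).
have cd (x v : phase R) := is_derive_phase_cut c x v Vs (step_smooth sX)
  (step_smooth sY) (step_derive sX) (step_derive sY).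
have diffd x : differentiable (phase_cut V X Y c) x.
  by have [] := Ck_succ (cs 1%N).
have dE (x v : phase R) : 'd (phase_cut V X Y c) x v = _ :=
  etrans (esym (deriveE v (diffd x))) (@derive_val _ _ _ _ _ _ _ (cd x v)).
have h0 x : 0 < phase_cut V X Y c x.
  apply: ltr_wpDl => //; rewrite mulr_ge0//; last by have /andP[] := step_bound sY (nsq x.2).
  by rewrite mulr_ge0//; have /andP[] := step_bound sX (nsq x.1).
split => //.
- rewrite /compactly_supported_d.
  pose K := [set q : plane R | nsq q <= rho1] `*` [set q : plane R | nsq q <= s1].
  have cK : compact K by apply: compact_setX; exact: compact_nsq_le.
  have clK : closed K.
    apply: compact_closed => //; exact: norm_hausdorff.
  have sub : [set x | exists v : phase R, 'd (phase_cut V X Y c) x v != 0] `<=` K.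
    move=> x [v]; rewrite dE => /eqP xv; split => /=; rewrite leNgt; apply/negP => lt1.
    - apply: xv; have [X0 X0'] := step_zero sX (ltW lt1).
      have [_ ->] := is_derive_radial_cut x.1 v.1 Vs (step_derive sX).
      by rewrite /radial_cut X0 X0' !(mul0r, mulr0, addr0).
    - apply: xv; have [Y0 Y0'] := step_zero sY (ltW lt1).
      by rewrite Y0 Y0' !(mul0r, mulr0, addr0).
  apply: (subclosed_compact _ cK); first exact: closed_closure.
  by move=> x /(closure_subset sub); rewrite -(closure_id K).1.
- move=> x; apply: lt_le_trans (h0 x) _; rewrite dE /= lerDl oppr_ge0.
  rewrite derive0 mulr0 addr0; apply: mulr_ge0_le0.
    by rewrite mulr_ge0//; have /andP[] := step_bound sX (nsq x.1).
  apply: mulr_le0_ge0; first by have /andP[] := step_slope sY (nsq x.2).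
  by rewrite mulr_ge0//; exact: nsq_ge0.
Qed.

(** With L the angular momentum, |L| <= |q| |p| <= rho + |p|^2/4, and the last term is absorbed by
    the |p|^2/2 in H0. *)
Lemma momentum_bound (B c rho : R) x : 0 <= rho -> nsq x.1 <= rho -> H0 x <= B + c ->
  nsq x.2 <= 4 * rho + 4 * (B + c).
Proof.
move=> rho0 xr; rewrite H0E => Hx.
have N0 := nsq_ge0 x.2.
have : `|ang x| <= rho + nsq x.2 / 4.
  rewrite -ler_sqr ?nnegrE ?normr_ge0 ?addr_ge0 ?divr_ge0//.
  rewrite real_normK ?num_real//; apply: le_trans (ang_sqr_le x) _.
  apply: le_trans (ler_wpM2r N0 xr) _.
  rewrite -subr_ge0.
  have -> : (rho + nsq x.2 / 4) ^+ 2 - rho * nsq x.2 = (rho - nsq x.2 / 4) ^+ 2 by field.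
  exact: sqr_ge0.
rewrite ler_norml => /andP[_ h]; lra.
Qed.

End cutoff.

(** * Comparison of the level sets and transfer of critical points *)

Section transfer.
Context {R : realType}.
Implicit Types (V : plane R -> R) (F : phase R -> R) (X Y : R -> R).

(** A critical point sees the Hamiltonian only through its zero set and its vector field along the
    path, and the Liouville term of the action depends on v alone. *)
Lemma Crit_pos_transfer F1 F2 (q0 q1 : plane R) :
  (forall v eta, Crit q0 q1 F1 (v, eta) -> forall t, t \in `[0, 1] ->
     F2 (v t) = 0 /\ ham_vf F1 (v t) = ham_vf F2 (v t)) ->
  Crit_pos q0 q1 F1 `<=` Crit_pos q0 q1 F2.
Proof.
move=> F12 [v eta] [C pos]; have h := F12 v eta C; have [pv vF F0] := C.
have C2 : Crit q0 q1 F2 (v, eta).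
  split; [exact: pv| |by move=> t /h[]].
  apply: (@filterS _ _ (ae_filter_ringOfSetsType (@lebesgue_measure R))) vF.
  by move=> t vt t01; rewrite (vt t01); have [_ ->] := h t t01.
split; first exact: C2.
move: pos; rewrite /action.
have -> : \int[@lebesgue_measure R]_(t in `[0, 1]) F1 (v t) =
    \int[@lebesgue_measure R]_(t in `[0, 1]) F2 (v t).
  apply: eq_Rintegral => t; rewrite inE/= => t01.
  by rewrite (F0 t t01) (h t t01).1.
by [].
Qed.

(** Makes statements about truncated potentials available for V itself. *)
Lemma radial_cut_cst1 V : radial_cut V (cst 1) = V.
Proof. by apply/funext => q; rewrite /radial_cut mulr1. Qed.

Section level_set.
Variables (V : plane R -> R) (X X' Y Y' : R -> R) (c B rho0 rho1 s1 : R).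
Hypotheses (V_smooth : smooth V) (V_ge0 : forall q, 0 <= V q)
  (rho01 : rho0 < rho1)
  (V_leB : forall q, nsq q <= rho1 -> V q <= B)
  (sX : step rho0 rho1 X X')
  (sY : step (4 * rho1 + 4 * (B + c)) s1 Y Y').
Local Notation U := (radial_cut V X).
Local Notation F := (fun x => H0 x - phase_cut V X Y c x).

Lemma derive_radial_cut q v : 'D_v U q =
  X (nsq q) * 'D_v V q + V q * (X' (nsq q) * (2 * dot q v)).
Proof. by have [_ ->] := is_derive_radial_cut q v V_smooth (step_derive sX). Qed.

Lemma slow_momentum x : nsq x.1 <= rho1 -> H0 x <= B + c ->
  Y (nsq x.2) = 1 /\ Y' (nsq x.2) = 0.
Proof.
move=> xr Hx; apply: (step_one sY).
exact: momentum_bound (le_trans (nsq_ge0 _) xr) xr Hx.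
Qed.

(** Whatever the value of Y, the level equation gives H0 <= B + c over the support of X. The
    momentum bound then forces Y = 1 and Y' = 0. Outside that support the truncated potential and
    its derivative vanish. *)
Lemma level_set_phase_cut x : F x = 0 ->
  H0 x = U x.1 + c /\ ham_vf F x = rotating_field U x.
Proof.
move=> /eqP; rewrite subr_eq0 => /eqP Hx.
have cd v := is_derive_phase_cut c x v V_smooth (step_smooth sX)
  (step_smooth sY) (step_derive sX) (step_derive sY).
have [xr|xr] := leP (nsq x.1) rho1.
  have HB : H0 x <= B + c.
    rewrite Hx lerD2r /radial_cut -[leRHS]mulr1.
    have [/andP[X0 X1] /andP[Y0 Y1]] :=
      (step_bound sX (nsq x.1), step_bound sY (nsq x.2)).
    apply: ler_pM => //; first by rewrite mulr_ge0.
    by rewrite -[leRHS]mulr1 ler_pM// V_leB.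
  have [Y1 Y'0] := slow_momentum xr HB.
  split; first by rewrite Hx /phase_cut Y1 mulr1.
  apply: ham_vf_H0B => v; apply: is_derive_eq (cd v) _.
  by rewrite Y1 Y'0 !(mul0r, mulr0) add0r mul1r.
have [X0 X'0] := step_zero sX (ltW xr).
have U0 : U x.1 = 0 by rewrite /radial_cut X0 mulr0.
split; first by rewrite Hx /phase_cut U0 mul0r.
apply: ham_vf_H0B => v; apply: is_derive_eq (cd v) _.
by rewrite U0 derive_radial_cut X0 X'0 !(mul0r, mulr0, addr0).
Qed.

Lemma level_set_potential x : H0 x - (V x.1 + c) = 0 ->
  H0 x = V x.1 + c /\ ham_vf (fun y => H0 y - (V y.1 + c)) x = rotating_field V x.
Proof.
move=> /eqP; rewrite subr_eq0 => /eqP Hx; split => //.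
apply: ham_vf_H0B => v.
have d : is_derive x v (fun y : phase R => V y.1) ('D_(v.1) V x.1).
  apply: DeriveDef.
    by apply: diff_derivable; have [] := Ck_succ (Ck_fst (V_smooth 1%N)).
  apply: (derive_comp_linear (l := fst)); first exact: continuous_fst.
  by have [] := Ck_succ (V_smooth 1%N).
by apply: is_derive_eq (is_deriveD d (is_derive_cst c x v)) _; rewrite addr0.
Qed.

Lemma field_inner x : nsq x.1 <= rho0 -> rotating_field U x = rotating_field V x.
Proof.
move=> /(step_one sX)[X1 X'0].
have e v : 'D_v U x.1 = 'D_v V x.1.
  by rewrite derive_radial_cut X1 X'0 !(mul0r, mulr0) addr0 mul1r.
by rewrite /rotating_field !e.
Qed.

(** In this disc X = 1, and either equation bounds H0 by B + c, hence |p|, so that Y = 1. *)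
Lemma level_sets_agree x : nsq x.1 <= rho0 ->
  F x = 0 <-> H0 x - (V x.1 + c) = 0.
Proof.
move=> xr; have [X1 X'0] := step_one sX xr.
have U1 : U x.1 = V x.1 by rewrite /radial_cut X1 mulr1.
split=> [/level_set_phase_cut[-> _]|]; first by rewrite U1 subrr.
move=> /eqP; rewrite subr_eq0 => /eqP Hx.
have xr1 : nsq x.1 <= rho1 by exact: le_trans xr (ltW rho01).
have [|Y1 _] := slow_momentum xr1; first by rewrite Hx lerD2r V_leB.
by rewrite Hx /phase_cut U1 Y1 mulr1 subrr.
Qed.

Lemma Crit_pos_phase_cut (q0 q1 : plane R) :
  (forall v eta, Crit q0 q1 F (v, eta) ->
     forall t, t \in `[0, 1] -> nsq (v t).1 <= rho0) ->
  Crit_pos q0 q1 F `<=` Crit_pos q0 q1 (fun x => H0 x - (V x.1 + c)).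
Proof.
move=> conf; apply: Crit_pos_transfer => v eta C t t01.
have vr := conf v eta C t t01.
have [_ _ /(_ t t01) F0] := C.
have V0 := (level_sets_agree vr).1 F0.
by rewrite (level_set_phase_cut F0).2 (level_set_potential V0).2 field_inner.
Qed.

Lemma Crit_pos_potential (q0 q1 : plane R) :
  (forall v eta, Crit q0 q1 (fun x => H0 x - (V x.1 + c)) (v, eta) ->
     forall t, t \in `[0, 1] -> nsq (v t).1 <= rho0) ->
  Crit_pos q0 q1 (fun x => H0 x - (V x.1 + c)) `<=` Crit_pos q0 q1 F.
Proof.
move=> conf; apply: Crit_pos_transfer => v eta C t t01.
have vr := conf v eta C t t01.
have [_ _ /(_ t t01) V0] := C.
have F0 := (level_sets_agree vr).2 V0.
by rewrite (level_set_phase_cut F0).2 (level_set_potential V0).2 field_inner.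
Qed.

End level_set.
End transfer.

(** * Convexity of the squared radius *)

Section convexity.
Context {R : realType}.
Variables (R1 a : R) (V : plane R -> R).
Hypotheses (R1_gt0 : 0 < R1) (a_gt0 : 0 < a) (V_smooth : smooth V)
  (V_ge0 : forall q, 0 <= V q)
  (V_le : forall r theta : R, R1 < r -> V (polar r theta) <= a / r)
  (V_dr : forall r theta : R, R1 < r ->
     0 <= dpolar_r V r theta + 2 / r * V (polar r theta)).

(** The product rule gives X q . grad V + 2 V |q|^2 X', and q . grad V >= - 2 V outside the disc. *)
Lemma derive_radial_cut_ge (X X' : R -> R) q :
  (forall t, is_derive t (1 : R) X (X' t)) -> 0 <= X (nsq q) ->
  R1 ^+ 2 < nsq q ->
  - (2 * V q * (X (nsq q) - nsq q * X' (nsq q))) <= 'D_q (radial_cut V X) q.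
Proof.
move=> Xd X0 /(potential_radial R1_gt0 V_smooth V_dr) VR.
have [_ ->] := is_derive_radial_cut q q V_smooth Xd.
by rewrite -/(nsq q); have := mulr_ge0 X0 VR; lra.
Qed.

Lemma sqrt_mul_potential_le q : R1 ^+ 2 < nsq q ->
  0 < Num.sqrt (nsq q) /\ Num.sqrt (nsq q) * V q <= a.
Proof.
move=> qR; have r0 := lt_trans R1_gt0 (sqrt_gt R1_gt0 qR); split => //.
by rewrite mulrC -ler_pdivlMr//; exact: (potential_le R1_gt0 V_le).
Qed.

(* If the expression were nonpositive, then |p|^2 <= 2 V E with
   E = X - r^2 X', and the energy relation would bound c by
   a r |X'| + sqrt (2 a r E). *)
Lemma convex_above_threshold (X X' : R -> R) (m c : R) x :
  0 < m -> m ^+ 3 = 2 * a -> 0 < c -> 4 * a * (3 * R1 + 2 * m) < c ^+ 2 ->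
  step ((R1 + 2 / 3 * m) ^+ 2) (4 * (R1 + 2 / 3 * m) ^+ 2) X X' ->
  H0 x = radial_cut V X x.1 + c -> R1 ^+ 2 < nsq x.1 ->
  0 < nsq x.2 + 'D_(x.1) (radial_cut V X) x.1.
Proof.
move=> m0 ma c0 cl sX; rewrite H0E => Hx xR.
have /andP[X0 X1] := step_bound sX (nsq x.1).
have /andP[_ X'0] := step_slope sX (nsq x.1).
have D := derive_radial_cut_ge (step_derive sX) X0 xR.
have [r0 rV] := sqrt_mul_potential_le xR.
have ang2 := ang_sqr_le x; have N0 := nsq_ge0 x.2; have w0 := V_ge0 x.1.
have rho2 : Num.sqrt (nsq x.1) ^+ 2 = nsq x.1 by rewrite sqr_sqrtr ?nsq_ge0.
rewrite /radial_cut in Hx.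
move: D; set dU := 'D_(x.1) _ _ => D.
move: rV r0 rho2 X0 X1 X'0 D Hx; set r := Num.sqrt _ => rV r0 rho2 X0 X1 X'0 D Hx.
have p0 : 0 < R1 + 2 / 3 * m by have R1p := R1_gt0; lra.
have := step_estimate p0 (ltW r0) sX; rewrite rho2 => -[E1 E2].
rewrite ltNge; apply/negP => ND.
move: (nsq x.1) (V x.1) (X (nsq x.1)) (X' (nsq x.1)) (nsq x.2) (ang x) dU
  w0 rV rho2 X0 X1 X'0 D Hx E1 E2 ND ang2 N0
  => rho w A A' N l dU' w0 rV rho2 A0 A1 A'0 D Hx E1 E2 ND ang2 N0.
have E0 : 0 <= A - rho * A'.
  by rewrite subr_ge0 (le_trans _ A0)// mulr_ge0_le0// -rho2 sqr_ge0.
have NE : N <= 2 * w * (A - rho * A') by lra.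
(* Here |q|^2 |p|^2 <= 2 (r V) (r E) <= 2 a (3 r0), by the decay of V and the estimate for the
   step. *)
have y2 : rho * N <= 6 * a * (R1 + 2 / 3 * m).
  have h1 : rho * N <= rho * (2 * w * (A - rho * A')).
    by apply: ler_wpM2l => //; rewrite -rho2 sqr_ge0.
  have h2 : rho * (2 * w * (A - rho * A')) = 2 * (r * w) * (r * (A - rho * A')).
    by rewrite -{1}rho2; ring.
  have h3 : 2 * (r * w) * (r * (A - rho * A')) <= 2 * a * (3 * (R1 + 2 / 3 * m)).
    by apply: ler_pM => //; rewrite ?mulr_ge0 ?(ltW r0)//; lra.
  by lra.
have y2' : `|l| ^+ 2 <= 6 * a * (R1 + 2 / 3 * m).
  by rewrite real_normK ?num_real//; exact: le_trans ang2 y2.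
have bE : a * (r * - A') <= 3 / 4 * a / (R1 + 2 / 3 * m).
  apply: le_trans (ler_wpM2l (ltW a_gt0) E1) _.
  rewrite le_eqVlt; apply/orP; left; apply/eqP; field.
  by rewrite gt_eqF//; have R1p := R1_gt0; lra.
apply: (energy_threshold R1_gt0 m0 ma c0 cl erefl bE (normr_ge0 l) y2').
(* One factor r is spent on r V <= a, the other stays with |X'|. *)
have h4 : w * (rho * - A') <= a * (r * - A').
  rewrite -rho2 expr2 -mulrA mulrA; apply: ler_wpM2r; last by rewrite mulrC.
  by rewrite mulr_ge0 ?(ltW r0)// oppr_ge0.
have := ler_norm (- l); rewrite normrN; lra.
Qed.

(** A quantitative form of L > - c on the circle |q| = R1. If L < d - c, then |p|^2 <= 2 (d + w),
    and L^2 <= R1^2 |p|^2 gives c^2 - 2 a R1 <= 2 d (c + R1^2) - d^2. By the choice of d the right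
    side is at most half the left side, which is positive. *)
Lemma ang_lower_bound (c w d : R) x : 0 < c -> 2 * a * R1 < c ^+ 2 ->
  d = (c ^+ 2 - 2 * a * R1) / (4 * (c + R1 ^+ 2)) ->
  nsq x.1 = R1 ^+ 2 -> 0 <= w <= a / R1 -> H0 x = w + c -> d <= c + ang x.
Proof.
move=> c0 cl dE xR /andP[w0 wl]; rewrite H0E => Hx.
have ang2 := ang_sqr_le x; rewrite xR in ang2.
have p0 : 0 < c + R1 ^+ 2 by rewrite ltr_wpDr// sqr_ge0.
have d4 : d * (4 * (c + R1 ^+ 2)) = c ^+ 2 - 2 * a * R1.
  by rewrite dE divfK// gt_eqF// mulr_gt0.
have wR : w * R1 <= a by rewrite -ler_pdivlMr.
move: (nsq x.2) (ang x) Hx ang2 => N l Hx ang2.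
rewrite leNgt; apply/negP => ld.
have NE : N = 2 * (l + w + c) by lra.
(* Needed to square the inequality: L < d - c < 0 gives L^2 >= (c - d)^2. *)
have dc : d < c.
  rewrite -(ltr_pM2r (_ : 0 < 4 * (c + R1 ^+ 2))) ?mulr_gt0// d4.
  have : 0 <= R1 ^+ 2 * c by rewrite mulr_ge0 ?sqr_ge0// ltW.
  have : 0 < a * R1 by rewrite mulr_gt0.
  have : 0 < c ^+ 2 by rewrite exprn_gt0.
  lra.
have l2 : (c - d) ^+ 2 <= l ^+ 2.
  rewrite -[l ^+ 2]sqrrN lerXn2r// ?nnegrE; lra.
have h1 : R1 ^+ 2 * N <= R1 ^+ 2 * (2 * (d + w)).
  by apply: ler_wpM2l; [exact: sqr_ge0|lra].
have h2 : R1 ^+ 2 * (2 * (d + w)) <= 2 * d * R1 ^+ 2 + 2 * (a * R1).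
  have := ler_wpM2l (ltW R1_gt0) wR; rewrite expr2; lra.
have d2 := sqr_ge0 d.
move: l2; rewrite sqrrB; lra.
Qed.

Hypothesis V_dt : forall r theta : R, R1 <= r -> dpolar_theta V r theta = 0.

Lemma radial_cut_angular (X X' : R -> R) q :
  (forall t, is_derive t (1 : R) X (X' t)) -> R1 ^+ 2 <= nsq q ->
  'D_(rot q) (radial_cut V X) q = 0.
Proof.
move=> Xd qR; have [_ ->] := is_derive_radial_cut q (rot q) V_smooth Xd.
rewrite (potential_angular R1_gt0 V_smooth V_dt qR) mulr0 add0r.
rewrite (_ : dot q (rot q) = 0) ?mulr0// /dot !mxE /=; ring.
Qed.

(** With L + c >= d carried over from the circle, |p|^2 = 2 (V X + c + L) gives |p|^2 + q . grad (V
    X) >= 2 d - 2 a r |X'| > 0. F and X are kept general so that both the truncated Hamiltonian and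
    the original one, with X = 1, are covered. *)
Lemma Crit_confined_symmetric (X X' : R -> R) (c d : R) F q0 q1 v eta :
  0 < c -> 2 * a * R1 < c ^+ 2 ->
  d = (c ^+ 2 - 2 * a * R1) / (4 * (c + R1 ^+ 2)) ->
  smooth X -> (forall t, is_derive t (1 : R) X (X' t)) ->
  (forall t, t <= R1 ^+ 2 -> X t = 1) -> (forall t, 0 <= X t) ->
  (forall t, X' t <= 0) -> (forall r, 0 <= r -> a * (r * - X' (r ^+ 2)) < d) ->
  smooth F ->
  (forall x, F x = 0 ->
     H0 x = radial_cut V X x.1 + c /\ ham_vf F x = rotating_field (radial_cut V X) x) ->
  nsq q0 <= R1 ^+ 2 -> nsq q1 <= R1 ^+ 2 -> Crit q0 q1 F (v, eta) ->
  forall t, t \in `[0, 1] -> nsq (v t).1 <= R1 ^+ 2.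
Proof.
move=> c0 cl dE Xs Xd X1 X0 X'0 Xslow Fs FU q0R q1R C.
have Us := smooth_radial_cut V_smooth Xs.
have FU2 x (Fx : F x = 0) := (FU x Fx).2.
apply: (confinement Fs Us FU2 C q0R q1R) => t t01 tR.
have [s [s01 sR angE]] := ang_conserved Fs Us FU2 C q0R q1R
  (fun q => @radial_cut_angular X X' q Xd) t01 tR.
have [_ _ F0] := C.
have [Hs _] := FU _ (F0 s s01).
have [Ht _] := FU _ (F0 t (subset_itv_oo_cc t01)).
have w01 : 0 <= radial_cut V X (v s).1 <= a / R1.
  rewrite /radial_cut X1 ?sR// mulr1 V_ge0/=.
  exact: (potential_le_boundary R1_gt0 a_gt0 V_smooth V_le).
have dl := ang_lower_bound c0 cl dE sR w01 Hs; rewrite angE in dl.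
have D := derive_radial_cut_ge Xd (X0 _) tR.
have [r0 rV] := sqrt_mul_potential_le tR.
have rho2 : Num.sqrt (nsq (v t).1) ^+ 2 = nsq (v t).1 by rewrite sqr_sqrtr ?nsq_ge0.
have := Xslow _ (ltW r0); rewrite rho2 => sl.
have w0 := V_ge0 (v t).1.
move: Ht; rewrite H0E /radial_cut => Ht.
move: D; set dU := 'D__ _ _ => D.
move: rV r0 rho2 D Ht sl; set r := Num.sqrt _ => rV r0 rho2 D Ht sl.
have h : a * (r * X' (nsq (v t).1)) <= nsq (v t).1 * X' (nsq (v t).1) * V (v t).1.
  have rX : r * X' (nsq (v t).1) <= 0 by rewrite mulr_ge0_le0// ltW.
  rewrite mulrC (le_trans (ler_wnM2l rX rV))// le_eqVlt; apply/orP; left; apply/eqP.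
  by rewrite -{2}rho2; ring.
lra.
Qed.

End convexity.

(** * Choice of the cutoffs and conclusion *)

Lemma enorm_le {R : realType} (q : plane R) (r : R) :
  enorm q <= r -> nsq q <= r ^+ 2.
Proof.
rewrite enormE => qr; rewrite -(sqr_sqrtr (nsq_ge0 q)) lerXn2r// nnegrE ?sqrtr_ge0//.
exact: le_trans (sqrtr_ge0 _) qr.
Qed.

Lemma cbrtK {R : realType} (x : R) : 0 <= x -> cbrt x ^+ 3 = x.
Proof.
move=> x0; rewrite /cbrt -powR_mulrn ?powR_ge0// -powRrM mulVf ?pnatr_eq0//.
by rewrite powRr1.
Qed.

Lemma sqrt_lt_sqr {R : realType} (y c : R) : 0 <= y -> Num.sqrt y < c ->
  0 < c /\ y < c ^+ 2.
Proof.
move=> y0 yc; have c0 : 0 < c by apply: le_lt_trans yc; exact: sqrtr_ge0.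
split => //; rewrite -(sqr_sqrtr y0) ltrXn2r// ?nnegrE ?sqrtr_ge0// ltW.
Qed.

Unset Implicit Arguments.

Theorem proposition1p2 (R : realType) (R1 a : R) (V : plane R -> R)
    (q0 q1 : plane R)
    (R1_gt0 : 0 < R1) (a_gt0 : 0 < a)
    (V_smooth : smooth V) (V_ge0 : forall q, 0 <= V q)
    (V_le : forall r theta : R, R1 < r -> V (polar r theta) <= a / r)
    (V_dr : forall r theta : R, R1 < r ->
       0 <= dpolar_r V r theta + 2 / r * V (polar r theta))
    (q0_le : enorm q0 <= R1) (q1_le : enorm q1 <= R1) :
  let H (x : phase R) := H0 x - V x.1 in
  (forall c : R,
     Num.max (cbrt (32 * a ^+ 2))
             (Num.sqrt (4 * a * (3 * R1 + 2 * cbrt (2 * a)))) < c ->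
     exists2 h : phase R -> R, admissible h &
       Crit_pos q0 q1 (fun x => H0 x - h x)
         `<=` Crit_pos q0 q1 (fun x => H x - c))
  /\
  ((forall r theta : R, R1 <= r -> dpolar_theta V r theta = 0) ->
   forall c : R,
     Num.max (inf (range V)) (Num.sqrt (2 * a * R1)) < c ->
     exists2 h : phase R -> R, admissible h &
       Crit_pos q0 q1 (fun x => H0 x - h x)
         = Crit_pos q0 q1 (fun x => H x - c)).
Proof.
move=> H; have HE c : (fun x => H x - c) = (fun x => H0 x - (V x.1 + c)).
  by apply/funext => x; rewrite /H opprD addrA.
have [q0R q1R] := (enorm_le q0_le, enorm_le q1_le).
(* The position is cut off between |q| = r0 and |q| = 2 r0. B bounds V there, and the momentum
   cutoff starts at the resulting value of [momentum_bound]; its width 1 is arbitrary. *)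
have setup (c r0 : R) : 0 < c -> 0 < r0 -> exists X X' B Y Y',
    [/\ step (r0 ^+ 2) (4 * r0 ^+ 2) X X', forall q, nsq q <= 4 * r0 ^+ 2 -> V q <= B,
        step (4 * (4 * r0 ^+ 2) + 4 * (B + c)) (4 * (4 * r0 ^+ 2) + 4 * (B + c) + 1) Y Y'
      & r0 ^+ 2 < 4 * r0 ^+ 2].
  move=> c0 r0_gt0; have r2 : 0 < r0 ^+ 2 by rewrite exprn_gt0.
  have r4 : r0 ^+ 2 < 4 * r0 ^+ 2 by lra.
  have [X [X' sX]] := smooth_step r4.
  have [B VB] := potential_bound V_smooth (ltW (lt_trans r2 r4)).
  have [|Y [Y' sY]] := smooth_step (r0 := 4 * (4 * r0 ^+ 2) + 4 * (B + c))
    (r1 := 4 * (4 * r0 ^+ 2) + 4 * (B + c) + 1); first by rewrite ltrDl.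
  by exists X, X', B, Y, Y'; split.
have R1r0 (r0 : R) : R1 <= r0 -> R1 ^+ 2 <= r0 ^+ 2.
  by move=> h; rewrite lerXn2r// nnegrE ltW// (lt_le_trans R1_gt0).
split=> [c|V_dt c].
- rewrite gt_max => /andP[_]; set m := cbrt (2 * a) => sc.
  have m0 : 0 < m by rewrite /m /cbrt powR_gt0// mulr_gt0.
  have ma : m ^+ 3 = 2 * a by rewrite /m cbrtK// mulr_ge0// ltW.
  have pos : 0 <= 4 * a * (3 * R1 + 2 * m).
    by rewrite mulr_ge0 ?addr_ge0 ?mulr_ge0// ltW.
  have [c0 cl] := sqrt_lt_sqr pos sc.
  (* The cutoff radius r0 balances the two terms that bound c: 3 a / (4 r0) from the slope of the
     cutoff, which falls with r0, and sqrt (6 a r0) from the angular momentum, which grows. *)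
  have r0_gt0 : 0 < R1 + 2 / 3 * m by lra.
  have [X [X' [B [Y [Y' [sX VB sY r01]]]]]] := setup c _ c0 r0_gt0.
  exists (phase_cut V X Y c).
    exact: (admissible_phase_cut V_smooth V_ge0 c0 sX sY).
  suff conf v eta : Crit q0 q1 (fun x => H0 x - phase_cut V X Y c x) (v, eta) ->
      forall t, t \in `[0, 1] -> nsq (v t).1 <= (R1 + 2 / 3 * m) ^+ 2.
    rewrite HE; exact: (Crit_pos_phase_cut V_smooth V_ge0 r01 VB sX sY conf).
  move=> C t t01.
  have Us := smooth_radial_cut V_smooth (step_smooth sX).
  have Fs := smooth_H0B (smooth_phase_cut c V_smooth (step_smooth sX) (step_smooth sY)).
  have FU x (Fx : H0 x - phase_cut V X Y c x = 0) :=
    level_set_phase_cut V_smooth V_ge0 VB sX sY Fx.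
  have FU2 x (Fx : H0 x - phase_cut V X Y c x = 0) := (FU x Fx).2.
  apply: (@le_trans _ _ (R1 ^+ 2)); last by apply: R1r0; lra.
  apply: (confinement Fs Us FU2 C q0R q1R) => // s s01 sR.
  have [_ _ F0] := C.
  have [Hx _] := FU _ (F0 s (subset_itv_oo_cc s01)).
  exact: (convex_above_threshold R1_gt0 a_gt0 V_smooth V_ge0 V_le V_dr
    m0 ma c0 cl sX Hx sR).
- rewrite gt_max => /andP[_ sc].
  have pos : 0 <= 2 * a * R1 by rewrite !mulr_ge0 ?ltW.
  have [c0 cl] := sqrt_lt_sqr pos sc.
  pose d := (c ^+ 2 - 2 * a * R1) / (4 * (c + R1 ^+ 2)).
  have d0 : 0 < d.
    by rewrite divr_gt0 ?subr_gt0// mulr_gt0// addr_gt0// exprn_gt0.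
  have ad0 : 0 < a / d by rewrite divr_gt0.
  (* This radius makes the cutoff slow enough: a r |X'| <= 3 a / (4 r0) < d. *)
  have r0_gt0 : 0 < R1 + a / d by rewrite addr_gt0.
  have [X [X' [B [Y [Y' [sX VB sY r01]]]]]] := setup c _ c0 r0_gt0.
  exists (phase_cut V X Y c).
    exact: (admissible_phase_cut V_smooth V_ge0 c0 sX sY).
  have Rr0 : R1 ^+ 2 <= (R1 + a / d) ^+ 2 by apply: R1r0; rewrite lerDl ltW.
  rewrite HE; apply/seteqP; split.
  + suff conf v eta : Crit q0 q1 (fun x => H0 x - phase_cut V X Y c x) (v, eta) ->
        forall t, t \in `[0, 1] -> nsq (v t).1 <= (R1 + a / d) ^+ 2.
      exact: (Crit_pos_phase_cut V_smooth V_ge0 r01 VB sX sY conf).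
    move=> C t t01; apply: (le_trans _ Rr0); move: t t01.
    apply: (Crit_confined_symmetric (X := X) (X' := X') (d := d)
      R1_gt0 a_gt0 V_smooth V_ge0 V_le V_dr V_dt c0 cl erefl
      (step_smooth sX) (step_derive sX) _ _ _ _ _ _ q0R q1R C).
    * by move=> t tR; have [] := step_one sX (le_trans tR Rr0).
    * by move=> t; have /andP[] := step_bound sX t.
    * by move=> t; have /andP[] := step_slope sX t.
    * move=> r r0; have [E _] := step_estimate r0_gt0 r0 sX.
      apply: le_lt_trans (ler_wpM2l (ltW a_gt0) E) _.
      rewrite mulrA ltr_pdivrMr ?mulr_gt0//.
      have -> : d * (4 * (R1 + a / d)) = 4 * (d * R1) + 4 * a by field; rewrite gt_eqF.
      have := mulr_gt0 d0 R1_gt0; lra.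
    * exact: smooth_H0B (smooth_phase_cut c V_smooth (step_smooth sX) (step_smooth sY)).
    * exact: level_set_phase_cut V_smooth V_ge0 VB sX sY.
  + suff conf v eta : Crit q0 q1 (fun x => H0 x - (V x.1 + c)) (v, eta) ->
        forall t, t \in `[0, 1] -> nsq (v t).1 <= (R1 + a / d) ^+ 2.
      exact: (Crit_pos_potential V_smooth V_ge0 r01 VB sX sY conf).
    move=> C t t01; apply: (le_trans _ Rr0); move: t t01.
    (* For the converse inclusion the Hamiltonian is not truncated, so the confinement statement is
       taken with X = 1 and X' = 0. *)
    have c1d (t : R) : is_derive t (1 : R) (cst 1 : R -> R) (cst 0 t).
      exact: is_derive_cst.
    apply: (Crit_confined_symmetric (X := cst 1) (X' := cst 0) (d := d)
      R1_gt0 a_gt0 V_smooth V_ge0 V_le V_dr V_dt c0 cl erefl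
      _ c1d _ _ _ _ _ _ q0R q1R C) => //.
    * by move=> n; exact: Ck_cst.
    * by move=> r _; rewrite /= oppr0 !mulr0.
    * apply: smooth_H0B => n; apply: CkD; last exact: Ck_cst.
      exact: Ck_fst.
    * by move=> x; rewrite radial_cut_cst1; exact: level_set_potential.
Qed.
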